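(* Let $p\ge 0$ and $m\ge 1$ be integers and let $z$ be a real number with $0<z<1$. Then $$\sum_{n=1}^{\infty} \frac{\zeta(2n)z^{2n}}{n(2n+1)\cdots(2n+m-1)(2n+m+p)} = \frac{\log(2\pi z)-H_{m-1}}{(m-1)!\,(p+m)} +\sum_{k=m}^{m+p} \frac{(-1)^m\,p!\,(-1)^{\lfloor \frac{k+1}{2} \rfloor}}{(p+m-k)!\,(2\pi z)^k}\,\mathrm{Cl}_{k+1}(2\pi z)+\delta_{\lfloor \frac{p+m}{2} \rfloor, \frac{p+m}{2}}\frac{(-1)^{m+1}p!\,(-1)^{\frac{p+m}{2}}}{(2\pi z)^{p+m}}\,\zeta(p+m+1)$$ $$\qquad - \frac{1}{(m-1)!\,(p+m)^2} - \sum_{k=1}^{\lfloor \frac{m-1}{2} \rfloor} \frac{(-1)^k\,\zeta(2k+1)}{(m-1-2k)!\,(m+p-2k)\,(2\pi z)^{2k}}.$$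
   Context: On the left, the denominator is $n\cdot\prod_{i=1}^{m-1}(2n+i)\cdot(2n+m+p)$ (empty product $=1$ when $m=1$). The generalized Clausen functions of a real variable $\theta$ are $\mathrm{Cl}_{2j}(\theta)=\sum_{k=1}^\infty \frac{\sin(k\theta)}{k^{2j}}$ for $j\ge1$ and $\mathrm{Cl}_{2j+1}(\theta)=\sum_{k=1}^\infty \frac{\cos(k\theta)}{k^{2j+1}}$ for $j\ge0$. $\zeta$ is the Riemann zeta function. $H_k=\sum_{i=1}^k \frac1i$ is the $k$-th harmonic number, $H_0=0$. $\delta_{a,b}$ is the Kronecker delta, so $\delta_{\lfloor n/2\rfloor,n/2}$ is $1$ if $n$ is even and $0$ if $n$ is odd; a term multiplied by it is read as $0$ when $n$ is odd. Empty sums are $0$. *)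

(* Defs.v *)
From Stdlib Require Import Reals Arith Factorial List.
From Coquelicot Require Import Coquelicot.
Open Scope R_scope.

(** The Riemann zeta function on the half-line [s > 1], where it is given by its
    Dirichlet series.  For [s <= 1] the value is meaningless. *)
Definition zeta (s : R) : R := Series (fun k : nat => / Rpower (INR (S k)) s).

(** Generalized Clausen function of order [n >= 1]: a sine series for even indices
    [n = 2j] ([j >= 1]) and a cosine series for odd indices [n = 2j+1] ([j >= 0]).
    The summation index is [S k]; [Cl 0] is meaningless. *)
Definition Cl (n : nat) (theta : R) : R :=
  Series (fun k : nat =>
    (if Nat.even n then sin (INR (S k) * theta) else cos (INR (S k) * theta))
    / INR (S k) ^ n).

Definition harmonic (k : nat) : R := sum_n_m (fun i => / INR i) 1 k.

(** Arguments are reals because the second one, [n/2], need not be an integer. *)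
Definition kronecker (a b : R) : R := if Req_dec_T a b then 1 else 0.

(** [n * (2n+1) * ... * (2n+m-1) * (2n+m+p)]; the middle product runs over
    [1 <= i <= m-1] and is empty for [m = 1]. *)
Definition denom (m p n : nat) : R :=
  INR n
  * fold_right Rmult 1 (map (fun i => INR (2 * n + i)) (seq 1 (m - 1)))
  * INR (2 * n + m + p).

(* Main.v *)
Require Import Defs.
From Stdlib Require Import Reals Arith Factorial List Lra Lia.
From Coquelicot Require Import Coquelicot.
Open Scope R_scope.

(** Put [x = 2 PI z], [m = q + 1], [N = m + p], and let [A_{q,p}] be the series on
    the left.  Multiplying by [z ^ N] turns the last factor [2 n + N] of the
    denominator into the effect of an integration: the derivative of
    [z ^ N * A_{q,p} z] is [z ^ (N - 1) * phi q z], where [phi q] is the series with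
    denominator [n (2 n + 1) ... (2 n + q)].  Since [phi (q + 1) = A_{q,0}], everything
    follows by repeated integration from [phi 0].

    The signed Clausen functions [E_k = (-1) ^ ((k + 1) / 2) * Cl (k + 1)] satisfy
    [E_{k+1}' = - E_k], so the polynomial-weighted sum of Clausen functions on the
    right has a telescoping derivative ([clausen_sum_derive]), and the right-hand
    side times [x ^ N], called [closed_form], has derivative [x ^ (N - 1)] times the
    closed form of [phi q] ([closed_form_derive]).  Both sides tend to 0 at 0 from the
    right; there the constant of integration [E_N(0)] appears, which is the term with
    the Kronecker delta.  Two functions with the same derivative whose difference
    tends to 0 are equal ([eq_of_same_derive]); this gives [integration_step].

    The induction starts from [phi 0 z = ln (2 PI z) - ln (2 sin (PI z))] together
    with [Cl_2' = - ln (2 sin (x / 2))].  The first identity ([log_sine_zeta]) is the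
    integrated partial fraction expansion of the cotangent; differentiating once more
    leads to the expansion of [1 / sin ^ 2], which is proved by Herglotz's trick: the
    difference [g] of its two sides is bounded and satisfies
    [g (z/2) + g ((z+1)/2) = 4 g z], hence vanishes ([csc2_partial_fractions]).  The second ([Cl_2_derive]) is the Fourier
    series of the logarithm of the sine, obtained with a locally uniform rate from
    the Dirichlet kernel. *)

(** * Termwise differentiation and uniqueness of primitives *)

(** By the mean value inequality, [fn n - f] is Lipschitz with constant [err n], being
    the limit of [fn n - fn m], whose derivative is at most [err n + err m].  The
    difference quotients of [f] are then close to those of [fn n]. *)
Lemma is_derive_uniform_limit (fn dn : nat -> R -> R) (f g : R -> R)
    (err : nat -> R) (a b : R) :
  (forall n x, a < x < b -> is_derive (fn n) x (dn n x)) ->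
  (forall x, a < x < b -> is_lim_seq (fun n => fn n x) (f x)) ->
  is_lim_seq err 0 ->
  (forall n x, a < x < b -> Rabs (dn n x - g x) <= err n) ->
  forall x, a < x < b -> is_derive f x (g x).
Proof.
intros Hd Hl He Hu x Hx.
assert (Hinc : forall n y, a < y < b ->
  Rabs ((fn n y - f y) - (fn n x - f x)) <= err n * Rabs (y - x)).
{ intros n y Hy.
  assert (Hmn : forall m,
    Rabs ((fn n y - fn m y) - (fn n x - fn m x)) <= (err n + err m) * Rabs (y - x)).
  { intros m.
    destruct (MVT_gen (fun t => fn n t - fn m t) x y (fun t => dn n t - dn m t))
      as [c [Hc Heq]].
    - intros t Ht. apply (is_derive_minus (fn n) (fn m)); apply Hd;
        revert Ht; unfold Rmin, Rmax; destruct Rle_dec; lra.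
    - intros t Ht. apply continuity_pt_filterlim.
      apply (ex_derive_continuous (fun t => fn n t - fn m t)).
      exists (dn n t - dn m t). apply (is_derive_minus (fn n) (fn m)); apply Hd;
        revert Ht; unfold Rmin, Rmax; destruct Rle_dec; lra.
    - simpl in Heq; rewrite Heq, Rabs_mult.
      apply Rmult_le_compat_r; [apply Rabs_pos|].
      assert (Hcab : a < c < b) by (revert Hc; unfold Rmin, Rmax; destruct Rle_dec; lra).
      generalize (Hu n c Hcab) (Hu m c Hcab); unfold Rabs; repeat destruct Rcase_abs; lra. }
  assert (L1 : is_lim_seq (fun m => Rabs ((fn n y - fn m y) - (fn n x - fn m x)))
     (Rabs ((fn n y - f y) - (fn n x - f x)))).
  { apply (is_lim_seq_abs _ (Finite _)).
    apply is_lim_seq_minus'; apply is_lim_seq_minus'; try apply is_lim_seq_const; now apply Hl. }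
  assert (L2 : is_lim_seq (fun m => (err n + err m) * Rabs (y - x))
     ((err n + 0) * Rabs (y - x))).
  { apply is_lim_seq_mult'; [|apply is_lim_seq_const].
    apply is_lim_seq_plus'; [apply is_lim_seq_const|exact He]. }
  generalize (is_lim_seq_le _ _ _ _ Hmn L1 L2); simpl. now rewrite Rplus_0_r. }
apply is_derive_Reals; intros eps Heps.
apply is_lim_seq_spec in He.
assert (Heps4 : 0 < eps / 4) by lra.
destruct (He (mkposreal _ Heps4)) as [N HN].
specialize (HN N (le_n N)); simpl in HN.
assert (HdN := proj1 (is_derive_Reals _ _ _) (Hd N x Hx)).
destruct (HdN _ Heps4) as [d Hdd].
assert (Hpos : 0 < Rmin d (Rmin (x - a) (b - x))).
{ repeat apply Rmin_case; try lra; apply cond_pos. }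
exists (mkposreal _ Hpos); intros h Hh0 Hh; simpl in Hh.
assert (Hhd : Rabs h < d) by (eapply Rlt_le_trans; [exact Hh|apply Rmin_l]).
assert (Hy : a < x + h < b).
{ assert (Rabs h < Rmin (x - a) (b - x)) by (eapply Rlt_le_trans; [exact Hh|apply Rmin_r]).
  assert (Rabs h < x - a) by (eapply Rlt_le_trans; [exact H|apply Rmin_l]).
  assert (Rabs h < b - x) by (eapply Rlt_le_trans; [exact H|apply Rmin_r]).
  revert H0 H1; unfold Rabs; destruct Rcase_abs; lra. }
specialize (Hdd h Hh0 Hhd).
specialize (Hinc N (x + h) Hy).
replace (x + h - x) with h in Hinc by ring.
assert (Hah : 0 < Rabs h) by now apply Rabs_pos_lt.
replace ((f (x + h) - f x) / h - g x) with
  (((fn N (x + h) - fn N x) / h - dn N x)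
   + (dn N x - g x)
   - ((fn N (x + h) - f (x + h)) - (fn N x - f x)) / h) by (now field).
assert (H3 : Rabs (((fn N (x + h) - f (x + h)) - (fn N x - f x)) / h) <= err N).
{ unfold Rdiv. rewrite Rabs_mult, Rabs_inv.
  apply Rmult_le_reg_r with (Rabs h); [exact Hah|].
  rewrite Rmult_assoc, Rinv_l, Rmult_1_r by lra. exact Hinc. }
generalize (Hu N x Hx). revert H3 HN Hdd.
generalize ((fn N (x + h) - fn N x) / h - dn N x).
generalize ((fn N (x + h) - f (x + h) - (fn N x - f x)) / h).
generalize (dn N x - g x). intros u v w.
unfold Rabs; repeat destruct Rcase_abs; lra.
Qed.

Lemma ex_series_dominated (a M : nat -> R) :
  (forall k, Rabs (a k) <= M k) -> ex_series M -> ex_series a.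
Proof. intros Ha HM. now apply (ex_series_le a M). Qed.

Lemma Series_tail_le (a M : nat -> R) (n : nat) :
  (forall k, Rabs (a k) <= M k) -> ex_series M ->
  Rabs (sum_n a n - Series a) <= Series M - sum_n M n.
Proof.
intros Ha HM.
assert (ea : ex_series a) by (apply (ex_series_le a M); auto).
rewrite (Series_incr_n a (S n)) by (auto; lia).
rewrite (Series_incr_n M (S n)) by (auto; lia).
simpl pred; rewrite <- !sum_n_Reals.
match goal with |- Rabs (?s - (?s + ?t)) <= ?u + ?v - ?u =>
  replace (s - (s + t)) with (- t) by ring; replace (u + v - u) with v by ring end.
rewrite Rabs_Ropp.
assert (ex_series (fun k => M (S n + k)%nat)) by (now apply (ex_series_incr_n M)).
eapply Rle_trans; [apply Series_Rabs|].
- apply (ex_series_le (fun k => Rabs (a (S n + k)%nat)) (fun k => M (S n + k)%nat)); auto.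
  intros k. change norm with Rabs. rewrite Rabs_Rabsolu; apply Ha.
- apply Series_le; auto. intros k; split; [apply Rabs_pos|apply Ha].
Qed.

Lemma Series_tail_lim (M : nat -> R) :
  ex_series M -> is_lim_seq (fun n => Series M - sum_n M n) 0.
Proof.
intros HM. replace 0 with (Series M - Series M) by ring.
apply is_lim_seq_minus'; [apply is_lim_seq_const|].
exact (Series_correct M HM).
Qed.

Lemma is_derive_Series (f df : nat -> R -> R) (M : nat -> R) (a b : R) :
  (forall k x, a < x < b -> is_derive (f k) x (df k x)) ->
  (forall x, a < x < b -> ex_series (fun k => f k x)) ->
  (forall k x, a < x < b -> Rabs (df k x) <= M k) -> ex_series M ->
  forall x, a < x < b ->
    is_derive (fun y => Series (fun k => f k y)) x (Series (fun k => df k x)).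
Proof.
intros Hd He HM eM x Hx.
apply (is_derive_uniform_limit (fun n y => sum_n (fun k => f k y) n)
  (fun n y => sum_n (fun k => df k y) n) _ (fun y => Series (fun k => df k y))
  (fun n => Series M - sum_n M n) a b); auto.
- intros n y Hy. apply (is_derive_sum_n f n y (fun k => df k y)); intros; now apply Hd.
- intros y Hy. exact (Series_correct _ (He y Hy)).
- now apply Series_tail_lim.
- intros n y Hy. apply Series_tail_le; auto.
Qed.

Lemma continuous_Series (f : nat -> R -> R) (M : nat -> R) (x : R) :
  (forall k y, continuous (f k) y) ->
  (forall k y, Rabs (f k y) <= M k) -> ex_series M ->
  continuous (fun y => Series (fun k => f k y)) x.
Proof.
intros Hc HM eM.
apply continuity_pt_filterlim.
assert (HL : forall y, Series (fun k => f k y) = Lim_seq (fun n => sum_n (fun k => f k y) n))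
  by reflexivity.
apply continuity_pt_ext with (1 := fun y => eq_sym (HL y)).
apply (CVU_cont_open (fun n y => sum_n (fun k => f k y) n) (fun _ => True)).
- apply open_true.
- intros eps. assert (H0 := Series_tail_lim M eM). apply is_lim_seq_spec in H0.
  destruct (H0 eps) as [N HN]. exists N; intros n Hn y _.
  eapply Rle_lt_trans; [apply (Series_tail_le _ M n); auto|].
  eapply Rle_lt_trans; [apply Rle_abs|].
  specialize (HN n Hn). now rewrite Rminus_0_r in HN.
- intros n y _. apply continuity_pt_filterlim.
  induction n as [|n IH].
  + apply continuous_ext with (f 0%nat); [intros; now rewrite sum_O|apply Hc].
  + apply continuous_ext with (fun z => plus (sum_n (fun k => f k z) n) (f (S n) z)).
    * intros; now rewrite sum_Sn.
    * apply (continuous_plus (fun z => sum_n (fun k => f k z) n) (f (S n))); [exact IH|apply Hc].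
- exact I.
Qed.

(** An initial condition at the endpoint 0, where the functions compared below are
    singular or their formulas degenerate. *)
Lemma eq_of_same_derive (u v d : R -> R) (b : R) :
  (forall x, 0 < x < b -> is_derive u x (d x)) ->
  (forall x, 0 < x < b -> is_derive v x (d x)) ->
  filterlim (fun x => u x - v x) (at_right 0) (locally 0) ->
  forall x, 0 < x < b -> u x = v x.
Proof.
intros Hu Hv Hl x Hx.
assert (Hc : forall y, 0 < y < x -> u y - v y = u x - v x).
{ intros y Hy. apply (eq_is_derive (fun t => u t - v t) y x); [|lra].
  intros t Ht. assert (Hm : is_derive (fun t => u t - v t) t (d t - d t)).
  { apply (is_derive_minus u v); [apply Hu|apply Hv]; lra. }
  replace (d t - d t) with 0 in Hm by ring. exact Hm. }
assert (H : filterlim (fun x => u x - v x) (at_right 0) (locally (u x - v x))).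
{ apply filterlim_ext_loc with (fun _ => u x - v x); [|apply filterlim_const].
  exists (mkposreal x (proj1 Hx)). intros y Hy Hy0.
  change (Rabs (y - 0) < x) in Hy. symmetry; apply Hc.
  revert Hy; unfold Rabs; destruct Rcase_abs; lra. }
assert (u x - v x = 0); [|lra].
exact (filterlim_locally_unique _ _ _ H Hl).
Qed.

(** * Zeta values, trigamma series and the expansion of the squared cosecant *)

Lemma INR_S_pos (k : nat) : 0 < INR (S k).
Proof. apply lt_0_INR; lia. Qed.

Lemma INR_S_ge1 (k : nat) : 1 <= INR (S k).
Proof. apply (le_INR 1); lia. Qed.

(** [1 / n ^ 2 <= 2 (1 / n - 1 / (n + 1))], and the right-hand side telescopes. *)
Lemma ex_series_inv_square : ex_series (fun k => / INR (S k) ^ 2).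
Proof.
apply (ex_series_dominated (fun k => / INR (S k) ^ 2)
         (fun k => 2 * (/ INR (S k) - / INR (S (S k))))).
- intros k. assert (H := INR_S_ge1 k). rewrite (S_INR (S k)).
  revert H; generalize (INR (S k)); intros x H.
  rewrite Rabs_right by (apply Rle_ge, Rlt_le, Rinv_0_lt_compat; nra).
  apply Rminus_le_0.
  replace (2 * (/ x - / (x + 1)) - / x ^ 2) with ((x - 1) / (x ^ 2 * (x + 1))) by (field; lra).
  apply Rdiv_le_0_compat; nra.
- apply (ex_series_scal_l 2 (fun k => / INR (S k) - / INR (S (S k)))). exists 1.
  assert (L : is_lim_seq (fun n => 1 - / INR (S (S n))) (1 - 0)).
  { apply is_lim_seq_minus'; [apply is_lim_seq_const|].
    apply (is_lim_seq_incr_1 (fun n => / INR (S n))).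
    apply (is_lim_seq_incr_1 (fun n => / INR n)).
    apply (is_lim_seq_inv INR p_infty); [apply is_lim_seq_INR|easy]. }
  rewrite Rminus_0_r in L.
  refine (is_lim_seq_ext _ _ 1 _ L).
  intros n. induction n as [|n IH].
  + rewrite sum_O. simpl. lra.
  + rewrite sum_Sn, <- IH. change plus with Rplus. rewrite !S_INR. lra.
Qed.

Lemma inv_pow_le (s k : nat) : (2 <= s)%nat -> 0 < / INR (S k) ^ s <= / INR (S k) ^ 2.
Proof.
intros Hs. assert (H := INR_S_ge1 k). split.
- apply Rinv_0_lt_compat, pow_lt; lra.
- apply Rinv_le_contravar; [apply pow_lt; lra|]. now apply Rle_pow.
Qed.

Lemma ex_series_inv_pow (s : nat) : (2 <= s)%nat -> ex_series (fun k => / INR (S k) ^ s).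
Proof.
intros Hs. apply (ex_series_dominated _ (fun k => / INR (S k) ^ 2)); [|exact ex_series_inv_square].
intros k. destruct (inv_pow_le s k Hs).
rewrite Rabs_right; lra.
Qed.

Lemma zeta_INR (s : nat) : zeta (INR s) = Series (fun k => / INR (S k) ^ s).
Proof.
apply Series_ext; intros k. rewrite Rpower_pow; [reflexivity|apply INR_S_pos].
Qed.

Lemma zeta_bounds (s : nat) : (2 <= s)%nat -> 0 <= zeta (INR s) <= zeta (INR 2).
Proof.
intros Hs; rewrite !zeta_INR; split.
- rewrite <- (Rmult_0_l (Series (fun k => / INR (S k) ^ s))), <- Series_scal_l.
  apply Series_le; [|now apply ex_series_inv_pow].
  intros k; destruct (inv_pow_le s k Hs); lra.
- apply Series_le; [|exact ex_series_inv_square].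
  intros k; destruct (inv_pow_le s k Hs); lra.
Qed.

Definition trigamma (z : R) : R := Series (fun k => / (z + INR k) ^ 2).

Lemma ex_trigamma (z : R) : 0 < z -> ex_series (fun k => / (z + INR k) ^ 2).
Proof.
intros Hz.
assert (Hc : 0 < Rmin z 1) by (apply Rmin_case; lra).
apply (ex_series_dominated _ (fun k => / Rmin z 1 ^ 2 * / INR (S k) ^ 2)).
- intros k. assert (Hk := pos_INR k).
  assert (H : Rmin z 1 * INR (S k) <= z + INR k).
  { rewrite S_INR. generalize (Rmin_l z 1) (Rmin_r z 1). nra. }
  assert (Hp := INR_S_pos k).
  rewrite Rabs_right by (apply Rle_ge, Rlt_le, Rinv_0_lt_compat, pow_lt; lra).
  rewrite <- Rinv_mult, <- Rpow_mult_distr.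
  apply Rinv_le_contravar; [apply pow_lt; nra|]. apply pow_incr; nra.
- apply (ex_series_scal_l (/ Rmin z 1 ^ 2) (fun k => / INR (S k) ^ 2)).
  exact ex_series_inv_square.
Qed.

Lemma trigamma_term_pos (z : R) (k : nat) : 0 < z -> 0 < / (z + INR k) ^ 2.
Proof. intros Hz. assert (H := pos_INR k). apply Rinv_0_lt_compat, pow_lt; lra. Qed.

Lemma trigamma_pos (z : R) : 0 < z -> 0 <= trigamma z.
Proof.
intros Hz. rewrite <- (Rmult_0_l (trigamma z)). unfold trigamma; rewrite <- Series_scal_l.
apply Series_le; [|now apply ex_trigamma].
intros k. generalize (trigamma_term_pos z k Hz); lra.
Qed.

Lemma trigamma_decr (y z : R) : 0 < y <= z -> trigamma z <= trigamma y.
Proof.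
intros Hz. apply Series_le; [|apply ex_trigamma; lra].
intros k. assert (H := pos_INR k). split; [apply Rlt_le, trigamma_term_pos; lra|].
apply Rinv_le_contravar; [apply pow_lt; lra|]. apply pow_incr; lra.
Qed.

Lemma trigamma_succ (z : R) : 0 < z -> trigamma z = / z ^ 2 + trigamma (1 + z).
Proof.
intros Hz. unfold trigamma at 1. rewrite Series_incr_1 by now apply ex_trigamma.
f_equal.
- simpl; now rewrite Rplus_0_r.
- apply Series_ext; intros k. rewrite S_INR.
  now replace (z + (INR k + 1)) with (1 + z + INR k) by ring.
Qed.

Lemma Series_even_odd (a : nat -> R) : ex_series a ->
  Series a = Series (fun k => a (2 * k)%nat + a (2 * k + 1)%nat).
Proof.
intros [l Hl]. rewrite (is_series_unique a l Hl). symmetry. apply is_series_unique.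
assert (L := is_lim_seq_subseq (sum_n a) l (fun n => 2 * n + 1)%nat).
refine (is_lim_seq_ext _ _ l _ (L _ Hl)).
- intros n; simpl. induction n as [|n IH].
  + simpl. rewrite sum_Sn, !sum_O. reflexivity.
  + replace (S n + (S n + 0) + 1)%nat with (S (S (n + (n + 0) + 1))) by lia.
    rewrite !sum_Sn, IH. rewrite <- plus_assoc. f_equal.
    change plus with Rplus. f_equal; f_equal; lia.
- apply eventually_subseq; intros; lia.
Qed.

(** The terms of even and of odd index of the series at [z]. *)
Lemma trigamma_dup (z : R) : 0 < z ->
  trigamma (z / 2) + trigamma ((z + 1) / 2) = 4 * trigamma z.
Proof.
intros Hz.
unfold trigamma at 3. rewrite (Series_even_odd _ (ex_trigamma z Hz)).
rewrite <- Series_scal_l. unfold trigamma.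
rewrite <- Series_plus by (apply ex_trigamma; lra).
apply Series_ext; intros k. assert (H := pos_INR k).
rewrite plus_INR, mult_INR; simpl INR. field; lra.
Qed.

Lemma sin_cubic_lb (y : R) : 0 <= y <= PI -> y - y ^ 3 / 6 <= sin y.
Proof.
intros Hy. generalize (sin_bound y 0 (proj1 Hy) (proj2 Hy)).
unfold sin_approx, sin_term; simpl. intros [H _].
eapply Rle_trans; [|exact H]. right. field.
Qed.

Lemma cos_quadratic_lb (y : R) : 0 <= y <= PI / 2 -> 1 - y ^ 2 / 2 <= cos y.
Proof.
intros Hy.
assert (H1 : - PI / 2 <= y) by (generalize PI_RGT_0; lra).
generalize (cos_bound y 0 H1 (proj2 Hy)).
unfold cos_approx, cos_term; simpl. intros [H _].
eapply Rle_trans; [|exact H]. right. field.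
Qed.

(** The constant 1/3 is what [sin y >= y - y ^ 3 / 6] gives for [y <= 2], so the crude
    bound [PI <= 4] is enough. *)
Lemma sin_linear_lb (y : R) : 0 <= y <= PI / 2 -> y / 3 <= sin y.
Proof.
intros Hy. generalize PI_4 (sin_cubic_lb y) PI_RGT_0; intros.
assert (y - y ^ 3 / 6 <= sin y) by (apply H0; lra). nra.
Qed.

Definition csc2_defect (z : R) : R :=
  PI ^ 2 / sin (PI * z) ^ 2 - trigamma z - trigamma (1 - z).

Lemma sin_pi_pos (z : R) : 0 < z < 1 -> 0 < sin (PI * z).
Proof. intros Hz. generalize PI_RGT_0; intros. apply sin_gt_0; nra. Qed.

Lemma csc2_defect_sym (z : R) : csc2_defect (1 - z) = csc2_defect z.
Proof.
unfold csc2_defect. replace (1 - (1 - z)) with z by ring.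
replace (PI * (1 - z)) with (PI - PI * z) by ring. rewrite sin_PI_x. ring.
Qed.

Lemma csc2_defect_dup (z : R) : 0 < z < 1 ->
  csc2_defect (z / 2) + csc2_defect ((z + 1) / 2) = 4 * csc2_defect z.
Proof.
intros Hz. unfold csc2_defect.
assert (E1 := trigamma_dup z (proj1 Hz)).
assert (E2 : trigamma ((1 - z) / 2) + trigamma ((1 - z + 1) / 2) = 4 * trigamma (1 - z))
  by (apply trigamma_dup; lra).
replace (1 - z / 2) with ((1 - z + 1) / 2) by field.
replace (1 - (z + 1) / 2) with ((1 - z) / 2) by field.
assert (S1 : 0 < sin (PI * (z / 2))) by (apply sin_pi_pos; lra).
assert (S2 : 0 < cos (PI * (z / 2))).
{ generalize PI_RGT_0; intros. apply cos_gt_0; nra. }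
replace (PI * ((z + 1) / 2)) with (PI / 2 + PI * (z / 2)) by field.
replace (PI * z) with (2 * (PI * (z / 2))) by field.
rewrite sin_2a, <- cos_sin.
assert (E : PI ^ 2 / sin (PI * (z / 2)) ^ 2 + PI ^ 2 / cos (PI * (z / 2)) ^ 2 =
  4 * (PI ^ 2 / (2 * sin (PI * (z / 2)) * cos (PI * (z / 2))) ^ 2)).
{ assert (Q := sin2_cos2 (PI * (z / 2))). unfold Rsqr in Q.
  replace (PI ^ 2 / sin (PI * (z / 2)) ^ 2 + PI ^ 2 / cos (PI * (z / 2)) ^ 2) with
    (PI ^ 2 * (sin (PI * (z / 2)) * sin (PI * (z / 2)) + cos (PI * (z / 2)) * cos (PI * (z / 2)))
      / (sin (PI * (z / 2)) ^ 2 * cos (PI * (z / 2)) ^ 2)) by (field; lra).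
  rewrite Q. field; lra. }
lra.
Qed.

(** For [0 < z <= 1/2] the poles [1 / z ^ 2] of [PI ^ 2 / sin ^ 2] and of [trigamma z] cancel
    and everything else is bounded; the symmetry [z -> 1 - z] gives the other half. *)
Lemma csc2_defect_bounded : exists B, forall z, 0 < z < 1 -> Rabs (csc2_defect z) <= B.
Proof.
(* 16 bounds PI ^ 2, and 3 bounds / sin y ^ 2 - / y ^ 2 for y = PI * z *)
assert (HB : forall z, 0 < z <= / 2 -> Rabs (csc2_defect z) <=
   16 * 3 + trigamma 1 + trigamma (/ 2)).
{ intros z Hz. unfold csc2_defect. rewrite (trigamma_succ z) by lra.
  assert (A1 := trigamma_pos (1 + z)). assert (A2 := trigamma_pos (1 - z)).
  assert (A3 := trigamma_decr 1 (1 + z)). assert (A4 := trigamma_decr (/ 2) (1 - z)).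
  assert (A5 := PI_4). assert (A6 := PI_RGT_0).
  assert (Y : 0 < PI * z <= PI / 2) by nra.
  assert (Y1 := sin_cubic_lb (PI * z)). assert (Y2 := sin_linear_lb (PI * z)).
  assert (Y3 := sin_lt_x (PI * z)).
  assert (G : 0 <= PI ^ 2 / sin (PI * z) ^ 2 - / z ^ 2 <= 16 * 3).
  { replace (/ z ^ 2) with (PI ^ 2 / (PI * z) ^ 2) by (field; lra).
    revert Y Y1 Y2 Y3. generalize (PI * z); intros y Y Y1 Y2 Y3.
    specialize (Y1 ltac:(lra)). specialize (Y2 ltac:(lra)). specialize (Y3 ltac:(lra)).
    assert (Q : 0 <= / sin y ^ 2 - / y ^ 2 <= 3).
    { split.
      - apply Rle_minus_r. rewrite Rplus_0_l. apply Rinv_le_contravar; [apply pow_lt; lra|].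
        apply pow_incr; lra.
      - apply Rle_minus_l. apply Rmult_le_reg_r with (sin y ^ 2 * y ^ 2).
        + apply Rmult_lt_0_compat; apply pow_lt; lra.
        + replace (/ sin y ^ 2 * (sin y ^ 2 * y ^ 2)) with (y ^ 2) by (field; lra).
          replace ((3 + / y ^ 2) * (sin y ^ 2 * y ^ 2)) with (sin y ^ 2 * (3 * y ^ 2 + 1))
            by (field; lra).
          assert (y ^ 2 - sin y ^ 2 <= y ^ 3 / 6 * (2 * y)).
          { replace (y ^ 2 - sin y ^ 2) with ((y - sin y) * (y + sin y)) by ring.
            apply Rmult_le_compat; lra. }
          assert (y ^ 2 / 9 <= sin y ^ 2).
          { replace (y ^ 2 / 9) with ((y / 3) ^ 2) by field. apply pow_incr; lra. }
          assert (y ^ 2 / 9 * (3 * y ^ 2) <= sin y ^ 2 * (3 * y ^ 2)).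
          { apply Rmult_le_compat_r; nra. }
          nra. }
    unfold Rdiv. assert (0 < PI ^ 2 <= 16) by (split; nra). nra. }
  specialize (A1 ltac:(lra)). specialize (A2 ltac:(lra)).
  specialize (A3 ltac:(lra)). specialize (A4 ltac:(lra)).
  apply Rabs_le. lra. }
eexists. intros z Hz.
destruct (Rle_dec z (/ 2)).
- apply HB; lra.
- rewrite <- csc2_defect_sym. apply HB; lra.
Qed.

(** A bound [B] for the defect improves to [B / 2] by the duplication formula, since
    both [z / 2] and [(z + 1) / 2] lie in [(0, 1)]; iterating, the defect is 0. *)
Lemma csc2_partial_fractions (z : R) : 0 < z < 1 ->
  PI ^ 2 / sin (PI * z) ^ 2 = trigamma z + trigamma (1 - z).
Proof.
destruct csc2_defect_bounded as [B HB].
assert (Hn : forall n z, 0 < z < 1 -> Rabs (csc2_defect z) <= B * (/ 2) ^ n).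
{ induction n as [|n IH]; intros y Hy.
  - simpl; rewrite Rmult_1_r; now apply HB.
  - assert (D := csc2_defect_dup y Hy).
    assert (I1 := IH (y / 2) ltac:(lra)). assert (I2 := IH ((y + 1) / 2) ltac:(lra)).
    simpl. revert D I1 I2. unfold Rabs; repeat destruct Rcase_abs; lra. }
intros Hz.
assert (E : csc2_defect z = 0).
{ apply Rabs_eq_0. apply Rle_antisym; [|apply Rabs_pos].
  assert (L : is_lim_seq (fun n => B * (/ 2) ^ n) (B * 0)).
  { apply is_lim_seq_mult'; [apply is_lim_seq_const|].
    apply is_lim_seq_geom. rewrite Rabs_right; lra. }
  rewrite Rmult_0_r in L.
  apply (is_lim_seq_le (fun _ => Rabs (csc2_defect z)) _ (Rabs (csc2_defect z)) 0
     (fun n => Hn n z Hz) (is_lim_seq_const _) L). }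
unfold csc2_defect in E. lra.
Qed.

(** * From the cotangent to the even zeta values *)

Lemma right_lim_0_linear_bound (f : R -> R) (C d : R) : 0 < d ->
  (forall x, 0 < x < d -> Rabs (f x) <= C * x) ->
  filterlim f (at_right 0) (locally 0).
Proof.
intros Hd Hf. apply filterlim_locally. intros eps.
assert (Hp : 0 < Rmin d (eps / (Rabs C + 1))).
{ generalize (Rabs_pos C) (cond_pos eps); intros. apply Rmin_case; [lra|].
  apply Rdiv_lt_0_compat; lra. }
exists (mkposreal _ Hp); intros x Hx Hx0. change (Rabs (x - 0) < Rmin d (eps / (Rabs C + 1))) in Hx.
change (Rabs (f x - 0) < eps). rewrite Rminus_0_r in *.
rewrite Rabs_right in Hx by lra.
assert (H1 := Rlt_le_trans _ _ _ Hx (Rmin_l _ _)).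
assert (H2 := Rlt_le_trans _ _ _ Hx (Rmin_r _ _)).
eapply Rle_lt_trans; [apply Hf; lra|].
assert (HC := Rabs_pos C).
apply Rle_lt_trans with (Rabs C * x); [generalize (Rle_abs C); nra|].
apply Rle_lt_trans with ((Rabs C + 1) * x); [nra|].
apply Rlt_le_trans with ((Rabs C + 1) * (eps / (Rabs C + 1))).
- apply Rmult_lt_compat_l; lra.
- right; field; lra.
Qed.

Lemma right_lim_continuous (f : R -> R) (a l : R) :
  continuous f a -> f a = l -> filterlim f (at_right a) (locally l).
Proof.
intros Hc <-. eapply filterlim_filter_le_1; [|exact Hc].
apply filter_le_within.
Qed.

Lemma right_lim_minus (f g : R -> R) (a l l' : R) :
  filterlim f (at_right a) (locally l) -> filterlim g (at_right a) (locally l') ->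
  filterlim (fun x => f x - g x) (at_right a) (locally (l - l')).
Proof.
intros Hf Hg.
assert (Hg' : filterlim (fun x => - g x) (at_right a) (locally (- l'))).
{ eapply filterlim_comp; [exact Hg|apply (filterlim_opp l')]. }
exact (filterlim_comp_2 _ _ _ Hf Hg' (filterlim_plus l (- l'))).
Qed.

Definition cot_sum (z : R) : R := Series (fun k => 2 * z / (INR (S k) ^ 2 - z ^ 2)).

(** Both factors of [n ^ 2 - z ^ 2] are at least [(1 - b) n] for [|z| < b], which
    provides the summable majorants [C / n ^ 2] below. *)
Lemma cot_sum_terms (b z : R) (k : nat) : 0 < b < 1 -> - b < z < b ->
  0 < (1 - b) * INR (S k) <= INR (S k) - z /\ (1 - b) * INR (S k) <= INR (S k) + z.
Proof. intros Hb Hz. assert (H := INR_S_ge1 k). repeat split; nra. Qed.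

Lemma ex_cot_sum_majorant (b C : R) :
  ex_series (fun k => C * (/ (1 - b) ^ 2 * / INR (S k) ^ 2)).
Proof.
apply (ex_series_scal_l C (fun k => / (1 - b) ^ 2 * / INR (S k) ^ 2)).
apply (ex_series_scal_l (/ (1 - b) ^ 2) (fun k => / INR (S k) ^ 2)).
exact ex_series_inv_square.
Qed.

Lemma cot_sum_derive (z : R) : -1 < z < 1 ->
  is_derive cot_sum z (trigamma (1 - z) + trigamma (1 + z)).
Proof.
intros Hz.
set (b := (1 + Rabs z) / 2).
assert (Hb : 0 < b < 1 /\ - b < z < b).
{ unfold b, Rabs; destruct Rcase_abs; lra. }
destruct Hb as [Hb Hzb].
assert (E : trigamma (1 - z) + trigamma (1 + z) =
  Series (fun k => / (INR (S k) - z) ^ 2 + / (INR (S k) + z) ^ 2)).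
{ unfold trigamma. rewrite <- Series_plus by (apply ex_trigamma; lra).
  apply Series_ext; intros k. rewrite S_INR.
  now replace (1 - z + INR k) with (INR k + 1 - z) by ring;
  replace (1 + z + INR k) with (INR k + 1 + z) by ring. }
rewrite E.
apply (is_derive_Series (fun k y => 2 * y / (INR (S k) ^ 2 - y ^ 2))
  (fun k y => / (INR (S k) - y) ^ 2 + / (INR (S k) + y) ^ 2)
  (fun k => 2 * (/ (1 - b) ^ 2 * / INR (S k) ^ 2)) (- b) b); auto.
- intros k y Hy. destruct (cot_sum_terms b y k Hb Hy) as [H1 H2].
  assert (INR (S k) ^ 2 - y ^ 2 <> 0).
  { replace (INR (S k) ^ 2 - y ^ 2) with ((INR (S k) - y) * (INR (S k) + y)) by ring.
    apply Rmult_integral_contrapositive_currified; lra. }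
  revert H1 H2 H. generalize (INR (S k)); intros K H1 H2 H.
  auto_derive; [exact H|]. field; repeat split; lra.
- intros y Hy. apply (ex_series_dominated _ (fun k => 2 * (/ (1 - b) ^ 2 * / INR (S k) ^ 2)));
    [|apply ex_cot_sum_majorant].
  intros k. destruct (cot_sum_terms b y k Hb Hy) as [H1 H2].
  replace (INR (S k) ^ 2 - y ^ 2) with ((INR (S k) - y) * (INR (S k) + y)) by ring.
  assert (0 < (1 - b) * INR (S k) * ((1 - b) * INR (S k)) <= (INR (S k) - y) * (INR (S k) + y)).
  { split; [nra|]. apply Rmult_le_compat; lra. }
  unfold Rdiv; rewrite Rabs_mult, Rabs_inv.
  rewrite (Rabs_right ((INR (S k) - y) * (INR (S k) + y))) by lra.
  apply Rmult_le_compat; [apply Rabs_pos|apply Rlt_le, Rinv_0_lt_compat; lra| |].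
  + apply Rabs_le; lra.
  + rewrite <- Rinv_mult. apply Rinv_le_contravar; [nra|]. nra.
- intros k y Hy. destruct (cot_sum_terms b y k Hb Hy) as [H1 H2].
  assert (0 < ((1 - b) * INR (S k)) ^ 2) by (apply pow_lt; lra).
  assert (/ (INR (S k) - y) ^ 2 <= / ((1 - b) * INR (S k)) ^ 2).
  { apply Rinv_le_contravar; [lra|]. apply pow_incr; lra. }
  assert (/ (INR (S k) + y) ^ 2 <= / ((1 - b) * INR (S k)) ^ 2).
  { apply Rinv_le_contravar; [lra|]. apply pow_incr; lra. }
  assert (0 < / (INR (S k) - y) ^ 2) by (apply Rinv_0_lt_compat, pow_lt; lra).
  assert (0 < / (INR (S k) + y) ^ 2) by (apply Rinv_0_lt_compat, pow_lt; lra).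
  rewrite <- Rinv_mult, <- Rpow_mult_distr. rewrite Rabs_right; lra.
- apply ex_cot_sum_majorant.
Qed.

Lemma Series_0 (a : nat -> R) : (forall k, a k = 0) -> Series a = 0.
Proof.
intros Ha. rewrite (Series_ext _ (fun k => 0 * a k)) by (intros; rewrite Ha; ring).
rewrite Series_scal_l; ring.
Qed.

(** Both sides are primitives of [PI ^ 2 / sin ^ 2 (PI z) - 1 / z ^ 2] that tend to 0 at
    0 from the right. *)
Lemma cot_partial_fractions (z : R) : 0 < z < 1 ->
  cot_sum z = / z - PI * cos (PI * z) / sin (PI * z).
Proof.
revert z.
apply (eq_of_same_derive cot_sum (fun z => / z - PI * cos (PI * z) / sin (PI * z))
  (fun z => PI ^ 2 / sin (PI * z) ^ 2 - / z ^ 2)).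
- intros z Hz. rewrite csc2_partial_fractions by exact Hz.
  rewrite (trigamma_succ z) by lra.
  replace (/ z ^ 2 + trigamma (1 + z) + trigamma (1 - z) - / z ^ 2) with
    (trigamma (1 - z) + trigamma (1 + z)) by ring.
  apply cot_sum_derive; lra.
- intros z Hz. assert (Hs := sin_pi_pos z Hz).
  auto_derive; [repeat split; lra|].
  assert (Q := sin2_cos2 (PI * z)). unfold Rsqr in Q.
  assert (Q' : PI ^ 2 / sin (PI * z) ^ 2 =
    PI ^ 2 * (sin (PI * z) * sin (PI * z) + cos (PI * z) * cos (PI * z)) / sin (PI * z) ^ 2)
    by (rewrite Q; field; lra).
  rewrite Q'. field; lra.
- replace 0 with (0 - 0) at 2 by ring. apply right_lim_minus.
  + apply right_lim_continuous.
    * apply (ex_derive_continuous cot_sum). eexists. apply cot_sum_derive; lra.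
    * apply Series_0; intros k. unfold Rdiv; ring.
  + apply (right_lim_0_linear_bound _ (2 * PI ^ 2) (/ 2)); [lra|].
    intros z Hz. assert (HPI := PI_RGT_0). assert (HPI4 := PI_4).
    assert (Hs := sin_pi_pos z ltac:(lra)).
    assert (Y : 0 < PI * z <= PI / 2) by nra.
    assert (Y1 := sin_cubic_lb (PI * z) ltac:(lra)).
    assert (Y2 := sin_linear_lb (PI * z) ltac:(lra)).
    assert (Y3 := sin_lt_x (PI * z) ltac:(lra)).
    assert (Y4 := cos_quadratic_lb (PI * z) ltac:(lra)).
    assert (Y5 := COS_bound (PI * z)).
    replace (/ z - PI * cos (PI * z) / sin (PI * z)) with
      (PI * ((sin (PI * z) - PI * z * cos (PI * z)) / (PI * z * sin (PI * z)))) by (field; lra).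
    rewrite Rabs_mult, (Rabs_right PI) by lra.
    replace (2 * PI ^ 2 * z) with (PI * (2 * (PI * z))) by ring.
    apply Rmult_le_compat_l; [lra|].
    revert Hs Y Y1 Y2 Y3 Y4 Y5. generalize (PI * z). intros y Hs Y Y1 Y2 Y3 Y4 Y5.
    assert (D : 0 < y * sin y) by nra.
    unfold Rdiv; rewrite Rabs_mult, Rabs_inv, (Rabs_right (y * sin y)) by lra.
    apply Rmult_le_reg_r with (y * sin y); [exact D|].
    rewrite Rmult_assoc, Rinv_l, Rmult_1_r by lra.
    assert (y * (y / 3) <= y * sin y) by nra.
    assert (2 * y * (y * (y / 3)) <= 2 * y * (y * sin y)) by nra.
    assert (y * (1 - y ^ 2 / 2) <= y * cos y <= y) by nra.
    assert (0 < y ^ 3) by (apply pow_lt; lra).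
    apply Rabs_le; nra.
Qed.

(** Truncating every zeta value after [K] terms costs at most
    [Series |a| * (zeta 2 - sum_(k <= K) 1 / (k + 1) ^ 2)], because the tails of
    [zeta (2 n)] are dominated by those of [zeta 2]; and the exchange is trivial for
    a finite sum over [k]. *)
Lemma Series_zeta_swap (a : nat -> R) : ex_series (fun j => Rabs (a j)) ->
  Series (fun j => a j * zeta (INR (2 * S j))) =
  Series (fun k => Series (fun j => a j * / INR (S k) ^ (2 * S j))).
Proof.
intros Ha. symmetry. apply is_series_unique.
assert (Hex : forall k, ex_series (fun j => a j * / INR (S k) ^ (2 * S j))).
{ intros k. apply (ex_series_dominated _ (fun j => Rabs (a j))); [|exact Ha].
  intros j. assert (H := INR_S_ge1 k).
  assert (H1 : 1 <= INR (S k) ^ (2 * S j)) by now apply pow_R1_Rle.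
  rewrite Rabs_mult, Rabs_inv, (Rabs_right (_ ^ _)) by lra.
  rewrite <- (Rmult_1_r (Rabs (a j))) at 2. apply Rmult_le_compat_l; [apply Rabs_pos|].
  rewrite <- Rinv_1. apply Rinv_le_contravar; lra. }
assert (Hz : ex_series (fun j => a j * zeta (INR (2 * S j)))).
{ apply (ex_series_dominated _ (fun j => Rabs (a j) * zeta (INR 2))).
  - intros j. rewrite Rabs_mult. apply Rmult_le_compat_l; [apply Rabs_pos|].
    destruct (zeta_bounds (2 * S j)); [lia|]. rewrite Rabs_right; lra.
  - apply (ex_series_scal_r (zeta (INR 2)) _ Ha). }
assert (Hs : forall K, ex_series (fun j => a j * sum_n (fun k => / INR (S k) ^ (2 * S j)) K)
  /\ sum_n (fun k => Series (fun j => a j * / INR (S k) ^ (2 * S j))) K =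
  Series (fun j => a j * sum_n (fun k => / INR (S k) ^ (2 * S j)) K)).
{ induction K as [|K [IH1 IH2]].
  - split.
    + eapply ex_series_ext; [|exact (Hex 0%nat)]. intros j; simpl. now rewrite sum_O.
    + rewrite sum_O. apply Series_ext; intros j. now rewrite sum_O.
  - assert (E : forall j, a j * sum_n (fun k => / INR (S k) ^ (2 * S j)) (S K) =
      a j * sum_n (fun k => / INR (S k) ^ (2 * S j)) K + a j * / INR (S (S K)) ^ (2 * S j)).
    { intros j. rewrite sum_Sn. change plus with Rplus. ring. }
    split.
    + eapply ex_series_ext; [intros j; symmetry; apply E|].
      apply (ex_series_plus _ _ IH1 (Hex (S K))).
    + rewrite sum_Sn, IH2, (Series_ext _ _ E), Series_plus; auto. }
assert (L : is_lim_seq (fun K => Series (fun j => a j * zeta (INR (2 * S j))) -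
   sum_n (fun k => Series (fun j => a j * / INR (S k) ^ (2 * S j))) K) 0).
{ apply is_lim_seq_abs_0.
  apply (is_lim_seq_le_le (fun _ => 0) _ (fun K => Series (fun j => Rabs (a j)) *
     (zeta (INR 2) - sum_n (fun k => / INR (S k) ^ 2) K))).
  - intros K. split; [apply Rabs_pos|].
    destruct (Hs K) as [H1 H2]. rewrite H2, <- Series_minus by auto.
    assert (B : forall j, Rabs (a j * zeta (INR (2 * S j)) -
        a j * sum_n (fun k => / INR (S k) ^ (2 * S j)) K) <=
        Rabs (a j) * (zeta (INR 2) - sum_n (fun k => / INR (S k) ^ 2) K)).
    { intros j. rewrite <- Rmult_minus_distr_l, Rabs_mult.
      apply Rmult_le_compat_l; [apply Rabs_pos|].
      rewrite !zeta_INR, Rabs_minus_sym.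
      apply Series_tail_le; [|exact ex_series_inv_square].
      intros k. destruct (inv_pow_le (2 * S j) k); [lia|]. rewrite Rabs_right; lra. }
    assert (ex_series (fun j => Rabs (a j) * (zeta (INR 2) - sum_n (fun k => / INR (S k) ^ 2) K)))
      by apply (ex_series_scal_r _ _ Ha).
    rewrite <- Series_scal_r.
    eapply Rle_trans; [apply Series_Rabs|].
    + eapply ex_series_dominated; [|exact H]. intros j. rewrite Rabs_Rabsolu. apply B.
    + apply Series_le; [|exact H]. intros j; split; [apply Rabs_pos|apply B].
  - apply is_lim_seq_const.
  - replace 0 with (Series (fun j => Rabs (a j)) * 0) by ring.
    apply is_lim_seq_mult'; [apply is_lim_seq_const|].
    rewrite zeta_INR. apply Series_tail_lim. exact ex_series_inv_square. }
change (is_lim_seq (sum_n (fun k => Series (fun j => a j * / INR (S k) ^ (2 * S j))))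
  (Series (fun j => a j * zeta (INR (2 * S j))))).
assert (L2 := is_lim_seq_minus' _ _ _ _
  (is_lim_seq_const (Series (fun j => a j * zeta (INR (2 * S j))))) L).
rewrite Rminus_0_r in L2.
refine (is_lim_seq_ext _ _ (Series (fun j => a j * zeta (INR (2 * S j)))) _ L2).
intros K; simpl; ring.
Qed.

Lemma pow_bound_dominated (c C b z : R) (i j : nat) :
  0 < b < 1 -> Rabs z <= b -> Rabs c <= C -> (j <= i)%nat -> Rabs (c * z ^ i) <= C * b ^ j.
Proof.
intros Hb Hz Hc Hij. rewrite Rabs_mult, <- RPow_abs.
apply Rmult_le_compat; [apply Rabs_pos|apply pow_le, Rabs_pos|exact Hc|].
apply Rle_trans with (b ^ i); [apply pow_incr; split; [apply Rabs_pos|exact Hz]|].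
replace i with (j + (i - j))%nat by lia. rewrite pow_add.
rewrite <- (Rmult_1_r (b ^ j)) at 2. apply Rmult_le_compat_l; [apply pow_le; lra|].
rewrite <- (pow1 (i - j)). apply pow_incr; lra.
Qed.

Lemma ex_series_geom_majorant (C b : R) : 0 < b < 1 -> ex_series (fun j => C * b ^ j).
Proof.
intros Hb. apply (ex_series_scal_l C (fun j => b ^ j)). exists (/ (1 - b)).
apply is_series_geom. rewrite Rabs_right; lra.
Qed.

Lemma between_abs_1 (z : R) : -1 < z < 1 -> exists b, 0 < b < 1 /\ - b < z < b.
Proof.
intros Hz. exists ((1 + Rabs z) / 2). unfold Rabs; destruct Rcase_abs; lra.
Qed.

Lemma ex_series_even_powers (c : nat -> R) (C : R) (N : nat) (z : R) :
  (forall j, Rabs (c j) <= C) -> -1 < z < 1 -> ex_series (fun j => c j * z ^ (2 * S j + N)).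
Proof.
intros Hc Hz. destruct (between_abs_1 z Hz) as [b [Hb Hzb]].
apply (ex_series_dominated _ (fun j => C * b ^ j)); [|now apply ex_series_geom_majorant].
intros j. apply pow_bound_dominated; auto; [apply Rabs_le; lra|lia].
Qed.

(** The exponents [2 n + N] cover both [phi 0] ([N = 0]) and the products
    [z ^ N * A_{q,p} z]. *)
Lemma is_derive_even_powers (c : nat -> R) (C : R) (N : nat) (z : R) :
  (forall j, Rabs (c j) <= C) -> -1 < z < 1 ->
  is_derive (fun y => Series (fun j => c j * y ^ (2 * S j + N) / INR (2 * S j + N))) z
    (Series (fun j => c j * z ^ (2 * S j + N - 1))).
Proof.
intros Hc Hz. destruct (between_abs_1 z Hz) as [b [Hb Hzb]].
assert (Hn : forall j, 1 <= INR (2 * S j + N)) by (intros; apply (le_INR 1); lia).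
apply (is_derive_Series (fun j y => c j * y ^ (2 * S j + N) / INR (2 * S j + N))
  (fun j y => c j * y ^ (2 * S j + N - 1)) (fun j => C * b ^ j) (- b) b); auto.
- intros j y Hy. generalize (Hn j). generalize (2 * S j + N)%nat; intros n H.
  auto_derive; [exact I|]. rewrite Nat.sub_1_r. field. lra.
- intros y Hy. apply (ex_series_dominated _ (fun j => C * b ^ j)); [|now apply ex_series_geom_majorant].
  intros j. assert (H := Hn j). unfold Rdiv. rewrite Rabs_mult, Rabs_inv, (Rabs_right (INR _)) by lra.
  apply Rle_trans with (Rabs (c j * y ^ (2 * S j + N)) * 1).
  + apply Rmult_le_compat_l; [apply Rabs_pos|]. rewrite <- Rinv_1. apply Rinv_le_contravar; lra.
  + rewrite Rmult_1_r. apply pow_bound_dominated; auto; [apply Rabs_le; lra|lia].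
- intros j y Hy. apply pow_bound_dominated; auto; [apply Rabs_le; lra|lia].
- now apply ex_series_geom_majorant.
Qed.

Lemma right_lim_even_powers (c : nat -> R) (C : R) (N : nat) :
  (forall j, Rabs (c j) <= C) ->
  filterlim (fun y => Series (fun j => c j * y ^ (2 * S j + N) / INR (2 * S j + N)))
    (at_right 0) (locally 0).
Proof.
intros Hc. apply right_lim_continuous.
- apply (ex_derive_continuous
    (fun y => Series (fun j => c j * y ^ (2 * S j + N) / INR (2 * S j + N)))).
  eexists. apply (is_derive_even_powers c C); auto; lra.
- apply Series_0. intros j. rewrite pow_i by lia. unfold Rdiv; ring.
Qed.

Lemma zeta_even_bound (j : nat) : Rabs (zeta (INR (2 * S j))) <= zeta (INR 2).
Proof.
destruct (zeta_bounds (2 * S j)); [lia|]. rewrite Rabs_right; lra.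
Qed.

(** After the exchange of summations the inner sums are geometric series. *)
Lemma zeta_even_cot_sum (z : R) : 0 < z < 1 ->
  Series (fun j => 2 * zeta (INR (2 * S j)) * z ^ (2 * S j + 0 - 1)) = cot_sum z.
Proof.
intros Hz.
assert (Ha : ex_series (fun j => Rabs (2 * z * (z ^ 2) ^ j))).
{ apply (ex_series_ext (fun j => 2 * z * (z ^ 2) ^ j)).
  - intros j. rewrite Rabs_right; [reflexivity|]. apply Rle_ge.
    apply Rmult_le_pos; [lra|]. apply pow_le, pow_le; lra.
  - apply ex_series_geom_majorant. nra. }
rewrite (Series_ext _ (fun j => 2 * z * (z ^ 2) ^ j * zeta (INR (2 * S j)))).
2:{ intros j. replace (2 * S j + 0 - 1)%nat with (S (2 * j)) by lia.
    rewrite <- pow_mult. simpl pow. ring. }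
rewrite (Series_zeta_swap _ Ha).
apply Series_ext; intros k. assert (Hk := INR_S_ge1 k).
set (K := INR (S k)) in *.
rewrite (Series_ext _ (fun j => 2 * z / K ^ 2 * (z ^ 2 / K ^ 2) ^ j)).
2:{ intros j. replace (2 * S j)%nat with (2 + 2 * j)%nat by lia.
    rewrite pow_add, pow_mult. unfold Rdiv. rewrite Rpow_mult_distr, pow_inv.
    field. split; [|lra]. apply pow_nonzero, pow_nonzero; lra. }
assert (z ^ 2 < K ^ 2) by nra.
rewrite Series_scal_l, Series_geom.
- field. split; [|lra]. nra.
- assert (0 <= z ^ 2 / K ^ 2 < 1); [|rewrite Rabs_right; lra].
  split; [apply Rdiv_le_0_compat; nra|]. apply Rlt_div_l; nra.
Qed.

(** Termwise, the derivative of the series is [2 zeta(2 n) z ^ (2 n - 1)], which sums to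
    [1 / z - PI cot (PI z)]; at 0 from the right, both sides tend to 0. *)
Lemma log_sine_zeta (z : R) : 0 < z < 1 ->
  Series (fun j => zeta (INR (2 * S j)) * z ^ (2 * S j) / INR (S j)) =
  ln (2 * PI * z) - ln (2 * sin (PI * z)).
Proof.
intros Hz.
rewrite (Series_ext _ (fun j => 2 * zeta (INR (2 * S j)) * z ^ (2 * S j + 0) / INR (2 * S j + 0))).
2:{ intros j. rewrite Nat.add_0_r, mult_INR. simpl (INR 2). field. generalize (INR_S_ge1 j); lra. }
assert (Hc : forall j, Rabs (2 * zeta (INR (2 * S j))) <= 2 * zeta (INR 2)).
{ intros j. rewrite Rabs_mult, Rabs_right by lra. generalize (zeta_even_bound j); lra. }
assert (HPI := PI_RGT_0).
revert z Hz.
apply (eq_of_same_derive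
  (fun z => Series (fun j => 2 * zeta (INR (2 * S j)) * z ^ (2 * S j + 0) / INR (2 * S j + 0)))
  (fun z => ln (2 * PI * z) - ln (2 * sin (PI * z)))
  (fun z => / z - PI * cos (PI * z) / sin (PI * z))).
- intros z Hz. rewrite <- cot_partial_fractions, <- zeta_even_cot_sum by exact Hz.
  apply (is_derive_even_powers _ (2 * zeta (INR 2))); auto; lra.
- intros z Hz. assert (Hs := sin_pi_pos z Hz).
  auto_derive; [split; [nra|lra]|]. field. lra.
- replace 0 with (0 - 0) at 2 by ring. apply right_lim_minus.
  + apply (right_lim_even_powers _ (2 * zeta (INR 2))); auto.
  + apply (right_lim_0_linear_bound _ (PI ^ 2) (/ 2)); [lra|].
    intros z Hz. assert (Hs := sin_pi_pos z ltac:(lra)). assert (HPI4 := PI_4).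
    assert (Y : 0 < PI * z <= PI / 2) by nra.
    assert (Y1 := sin_cubic_lb (PI * z) ltac:(lra)).
    assert (Y2 := sin_linear_lb (PI * z) ltac:(lra)).
    assert (Y3 := sin_lt_x (PI * z) ltac:(lra)).
    replace (2 * PI * z) with (2 * (PI * z)) by ring.
    rewrite (ln_mult 2 (PI * z)), (ln_mult 2 (sin (PI * z))) by lra.
    assert (YP : PI * z * (PI * z) / 2 <= PI ^ 2 * z) by nra.
    revert Hs Y Y1 Y2 Y3 YP. generalize (PI * z); intros y Hs Y Y1 Y2 Y3 YP.
    assert (A1 : ln (sin y) < ln y) by (apply ln_increasing; lra).
    (* from ln t <= t - 1 at t = y / sin y *)
    assert (A2 : ln y - ln (sin y) <= y / sin y - 1).
    { rewrite <- ln_div by lra.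
      assert (Q : 0 < y / sin y) by (apply Rdiv_lt_0_compat; lra).
      generalize (exp_ineq1_le (ln (y / sin y))). rewrite exp_ln by exact Q. lra. }
    assert (A3 : y / sin y - 1 <= y * y / 2).
    { apply Rle_minus_l. apply Rle_div_l; [lra|].
      assert (y ^ 3 / 6 <= (y * y / 2) * (y / 3)) by (right; field).
      assert ((y * y / 2) * (y / 3) <= (y * y / 2) * sin y) by (apply Rmult_le_compat_l; nra).
      lra. }
    apply Rabs_le; lra.
Qed.

(** * Derivatives of the Clausen functions *)

(** Lemmas on [sum_n] and [is_derive] state equalities at the carrier of an abstract
    structure; [field] and [ring] need the carrier to be visibly [R]. *)
Ltac as_real_eq := match goal with |- ?u = ?v => change (@eq R u v) end.

Definition cos_sum (n : nat) (x : R) : R := sum_n (fun k => cos (INR (S k) * x) / INR (S k)) n.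

Lemma dirichlet_sine_sum (n : nat) (x : R) :
  sum_n (fun k => sin (INR (S k) * x)) n * (2 * sin (x / 2)) =
  cos (x / 2) - cos ((INR (S n) + / 2) * x).
Proof.
assert (H : forall k, sin (INR (S k) * x) * (2 * sin (x / 2)) =
  cos ((INR (S k) - / 2) * x) - cos ((INR (S k) + / 2) * x)).
{ intros k.
  replace ((INR (S k) - / 2) * x) with (INR (S k) * x - x / 2) by field.
  replace ((INR (S k) + / 2) * x) with (INR (S k) * x + x / 2) by field.
  rewrite cos_minus, cos_plus. ring. }
induction n as [|n IH].
- rewrite sum_O, H. f_equal. f_equal. simpl INR. field.
- rewrite sum_Sn. change plus with Rplus. rewrite Rmult_plus_distr_r, IH, H.
  rewrite (S_INR (S n)).
  replace (INR (S n) + 1 - / 2) with (INR (S n) + / 2) by field. ring.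
Qed.

Lemma cos_sum_derive (n : nat) (x : R) :
  is_derive (cos_sum n) x (- sum_n (fun k => sin (INR (S k) * x)) n).
Proof.
assert (E : - sum_n (fun k => sin (INR (S k) * x)) n =
  sum_n (fun k => - sin (INR (S k) * x)) n).
{ induction n as [|n IH]; [now rewrite !sum_O|].
  rewrite !sum_Sn, <- IH. change plus with Rplus. ring. }
rewrite E. unfold cos_sum.
apply (is_derive_sum_n (fun k y => cos (INR (S k) * y) / INR (S k)) n x
  (fun k => - sin (INR (S k) * x))).
intros k _. generalize (INR_S_pos k). generalize (INR (S k)); intros K HK.
auto_derive; [exact I|]. field. lra.
Qed.

(** The oscillating part [cos (M x) / (2 sin (x / 2))], with [M = n + 3/2], of the
    derivative of [cos_sum n x + ln (2 sin (x / 2))] is of order 1.  Subtracting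
    [sin (M x) / (2 M sin (x / 2))], which amounts to one integration by parts, leaves
    a derivative of order [1 / M]. *)
Definition log_sine_remainder (n : nat) (x : R) : R :=
  cos_sum n x + ln (2 * sin (x / 2))
  - sin ((INR (S n) + / 2) * x) / (2 * (INR (S n) + / 2) * sin (x / 2)).

Lemma log_sine_remainder_derive (n : nat) (x : R) : 0 < x < 2 * PI ->
  is_derive (log_sine_remainder n) x
    (sin ((INR (S n) + / 2) * x) * cos (x / 2) / (4 * (INR (S n) + / 2) * sin (x / 2) ^ 2)).
Proof.
intros Hx. assert (Hs : 0 < sin (x / 2)) by (apply sin_gt_0; lra).
assert (Hn := INR_S_pos n).
assert (D := dirichlet_sine_sum n x).
assert (H1 := cos_sum_derive n x).
unfold log_sine_remainder.
set (M := INR (S n) + / 2) in *.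
assert (HM : 0 < M) by (unfold M; lra).
assert (H2 : is_derive (fun y => ln (2 * sin (y / 2)) - sin (M * y) / (2 * M * sin (y / 2))) x
  (cos (x / 2) / (2 * sin (x / 2)) - cos (M * x) / (2 * sin (x / 2))
   + sin (M * x) * cos (x / 2) / (4 * M * sin (x / 2) ^ 2))).
{ clearbody M. auto_derive.
  - repeat split; try lra. apply Rmult_integral_contrapositive_currified; lra.
  - change (x * / 2) with (x / 2). field. lra. }
assert (H3 := is_derive_plus _ _ _ _ _ H1 H2).
match type of H3 with is_derive _ _ ?l =>
  replace (sin (M * x) * cos (x / 2) / (4 * M * sin (x / 2) ^ 2)) with l end.
- eapply is_derive_ext; [|exact H3]. intros y; change plus with Rplus; simpl; ring.
- change plus with Rplus.
  assert (E : @eq R (sum_n (fun k => sin (INR (S k) * x)) n)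
    ((cos (x / 2) - cos (M * x)) / (2 * sin (x / 2)))) by
    (apply (Rmult_eq_reg_r (2 * sin (x / 2))); [rewrite D; field|]; lra).
  rewrite E. as_real_eq; field. lra.
Qed.

Lemma alternating_geometric_sum (t : R) (n : nat) : -1 < t ->
  sum_n (fun k => (-1) ^ S k * t ^ k) n = ((- t) ^ S n - 1) / (1 + t).
Proof.
intros Ht. induction n as [|n IH].
- rewrite sum_O. simpl. as_real_eq; field. lra.
- rewrite sum_Sn, IH. change plus with Rplus. as_real_eq.
  replace ((-1) ^ S (S n) * t ^ S n) with (- (- t) ^ S n).
  + rewrite <- (tech_pow_Rmult (- t) (S n)). field. lra.
  + replace (- t) with (-1 * t) by ring. rewrite Rpow_mult_distr. simpl. ring.
Qed.

Lemma is_derive_pow_div (c : R) (n : nat) (t : R) :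
  is_derive (fun y => c * y ^ S n / INR (S n)) t (c * t ^ n).
Proof.
assert (H : forall m, (0 < m)%nat -> is_derive (fun y => c * y ^ m / INR m) t (c * t ^ pred m)).
{ intros m Hm. assert (Hm' := lt_0_INR m Hm). auto_derive; [exact I|]. field. lra. }
apply (H (S n)). lia.
Qed.

(** With [f] the Taylor remainder of [ln (1 + t)], the functions
    [t ^ (n + 2) / (n + 2) - f t] and [t ^ (n + 2) / (n + 2) + f t] vanish at 0 and are
    nondecreasing for [0 <= t <= 1]. *)
Lemma alternating_harmonic_bound (n : nat) :
  Rabs (cos_sum n PI + ln 2) <= / INR (S (S n)).
Proof.
set (f := fun t => sum_n (fun k => (-1) ^ S k * t ^ S k / INR (S k)) n + ln (1 + t)).
assert (Hf : forall t, -1 < t -> is_derive f t ((- t) ^ S n / (1 + t))).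
{ intros t Ht.
  assert (H1 : is_derive (fun t => sum_n (fun k => (-1) ^ S k * t ^ S k / INR (S k)) n) t
     (sum_n (fun k => (-1) ^ S k * t ^ k) n)).
  { apply (is_derive_sum_n (fun k y => (-1) ^ S k * y ^ S k / INR (S k)) n t
      (fun k => (-1) ^ S k * t ^ k)).
    intros k _. apply is_derive_pow_div. }
  assert (H2 : is_derive (fun t => ln (1 + t)) t (/ (1 + t))).
  { auto_derive; [lra|]. field; lra. }
  assert (H3 := is_derive_plus _ _ _ _ _ H1 H2).
  replace ((- t) ^ S n / (1 + t)) with
    (plus (sum_n (fun k => (-1) ^ S k * t ^ k) n) (/ (1 + t))); [exact H3|].
  rewrite alternating_geometric_sum by exact Ht. change plus with Rplus. as_real_eq. field. lra. }
assert (f0 : f 0 = 0).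
{ unfold f. rewrite Rplus_0_r, ln_1, Rplus_0_r.
  clear. induction n as [|n IH].
  - rewrite sum_O. simpl. unfold Rdiv; ring.
  - rewrite sum_Sn, IH. change plus with Rplus. simpl. unfold Rdiv; ring. }
assert (f1 : f 1 = cos_sum n PI + ln 2).
{ unfold f, cos_sum. replace (1 + 1) with 2 by ring. f_equal.
  apply sum_n_ext. intros k. rewrite pow1. f_equal.
  rewrite Rmult_1_r. clear. induction k as [|k IH].
  - simpl INR. rewrite Rmult_1_l, cos_PI. ring.
  - rewrite (S_INR (S k)), Rmult_plus_distr_r, Rmult_1_l, neg_cos, <- IH. simpl; ring. }
rewrite <- f1.
assert (HS := INR_S_pos (S n)).
assert (Hsign : forall e, e = 1 \/ e = -1 -> e * f 1 <= / INR (S (S n))).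
{ intros e He.
  destruct (MVT_gen (fun t => t ^ S (S n) / INR (S (S n)) - e * f t) 0 1
    (fun t => t ^ S n - e * ((- t) ^ S n / (1 + t)))) as [c [Hc Heq]].
  - intros t Ht. rewrite Rmin_left, Rmax_right in Ht by lra.
    apply (is_derive_minus (fun t => t ^ S (S n) / INR (S (S n))) (fun t => e * f t)).
    + rewrite <- (Rmult_1_l (t ^ S n)).
      apply (is_derive_ext (fun t => 1 * t ^ S (S n) / INR (S (S n)))).
      { intros y. now rewrite Rmult_1_l. }
      apply is_derive_pow_div.
    + apply is_derive_scal. apply Hf; lra.
  - intros t Ht. rewrite Rmin_left, Rmax_right in Ht by lra.
    apply continuity_pt_filterlim.
    apply (continuous_minus (fun t => t ^ S (S n) / INR (S (S n))) (fun t => e * f t)).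
    + apply (ex_derive_continuous (fun t => t ^ S (S n) / INR (S (S n)))).
      generalize (S (S n)); intros; now auto_derive.
    + apply (continuous_scal_r e f). apply (ex_derive_continuous f). eexists; apply Hf; lra.
  - rewrite Rmin_left, Rmax_right in Hc by lra.
    assert (Hp : 0 <= c ^ S n) by (apply pow_le; lra).
    assert (Hq : e * ((- c) ^ S n / (1 + c)) <= c ^ S n).
    { eapply Rle_trans; [apply Rle_abs|].
      rewrite Rabs_mult. unfold Rdiv. rewrite Rabs_mult, <- RPow_abs, Rabs_Ropp, Rabs_inv.
      rewrite (Rabs_right c), (Rabs_right (1 + c)) by lra.
      replace (Rabs e) with 1 by (destruct He; subst; unfold Rabs; destruct Rcase_abs; lra).
      rewrite Rmult_1_l. rewrite <- (Rmult_1_r (c ^ S n)) at 2.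
      apply Rmult_le_compat_l; [exact Hp|]. rewrite <- Rinv_1. apply Rinv_le_contravar; lra. }
    cbv beta in Heq. rewrite f0, pow1, pow_i in Heq by lia. unfold Rdiv in Heq. nra. }
generalize (Hsign 1 ltac:(auto)) (Hsign (-1) ltac:(auto)); intros.
apply Rabs_le; lra.
Qed.

(** The remainder varies by [O(1 / n)] between [PI] and [x], as long as [sin (y / 2)]
    stays above [s0] in between, and at [PI] the partial sum is that of the
    alternating harmonic series, with sum [- ln 2]. *)
Lemma log_sine_fourier_uniform (s0 : R) : 0 < s0 -> exists C, forall n x,
  0 < x < 2 * PI -> s0 <= sin (x / 2) ->
  (forall y, Rmin PI x <= y <= Rmax PI x -> s0 <= sin (y / 2)) ->
  Rabs (cos_sum n x - (- ln (2 * sin (x / 2)))) <= C * / INR (S n).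
Proof.
intros Hs0. exists (PI / (4 * s0 ^ 2) + 1 + / 2 + / (2 * s0)).
intros n x Hx Hsx Hs.
assert (Hn := INR_S_pos n). assert (HPI := PI_RGT_0).
set (M := INR (S n) + / 2).
assert (HM : 0 < INR (S n) < M) by (unfold M; lra).
assert (HI : 0 < / M <= / INR (S n)).
{ split; [apply Rinv_0_lt_compat; lra|apply Rinv_le_contravar; lra]. }
assert (Hin : forall y, Rmin PI x <= y <= Rmax PI x -> 0 < y < 2 * PI).
{ intros y. unfold Rmin, Rmax; destruct Rle_dec; lra. }
destruct (MVT_gen (log_sine_remainder n) PI x
   (fun x => sin (M * x) * cos (x / 2) / (4 * M * sin (x / 2) ^ 2))) as [c [Hc Heq]].
- intros y Hy. apply log_sine_remainder_derive. apply Hin; lra.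
- intros y Hy. apply continuity_pt_filterlim.
  apply (ex_derive_continuous (log_sine_remainder n)).
  eexists; apply log_sine_remainder_derive; now apply Hin.
- assert (B1 : Rabs (log_sine_remainder n x - log_sine_remainder n PI) <= PI / (4 * s0 ^ 2) * / INR (S n)).
  { rewrite Heq, Rabs_mult. assert (Hsc := Hs c Hc).
    assert (Rabs (x - PI) <= PI) by (apply Rabs_le; lra).
    assert (s0 ^ 2 <= sin (c / 2) ^ 2) by (apply pow_incr; lra).
    assert (Hs2 : 0 < s0 ^ 2) by now apply pow_lt.
    assert (Rabs (sin (M * c) * cos (c / 2) / (4 * M * sin (c / 2) ^ 2)) <= 1 * / (4 * s0 ^ 2) * / INR (S n)).
    { set (h := c / 2) in *. unfold Rdiv. rewrite Rabs_mult, Rabs_inv, (Rmult_assoc 1).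
      rewrite (Rabs_right (4 * M * sin h ^ 2)) by nra.
      apply Rmult_le_compat; [apply Rabs_pos|apply Rlt_le, Rinv_0_lt_compat; nra| |].
      - rewrite Rabs_mult. generalize (SIN_bound (M * c)) (COS_bound h); intros.
        assert (Rabs (sin (M * c)) <= 1) by (apply Rabs_le; lra).
        assert (Rabs (cos h) <= 1) by (apply Rabs_le; lra).
        generalize (Rabs_pos (sin (M * c))) (Rabs_pos (cos h)); nra.
      - rewrite <- Rinv_mult. apply Rinv_le_contravar; nra. }
    replace (PI / (4 * s0 ^ 2) * / INR (S n)) with (1 * / (4 * s0 ^ 2) * / INR (S n) * PI)
      by (field; lra).
    apply Rmult_le_compat; auto using Rabs_pos. }
  assert (B2 := alternating_harmonic_bound n).
  assert (B2' : / INR (S (S n)) <= / INR (S n)).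
  { apply Rinv_le_contravar; [exact Hn|]. apply le_INR; lia. }
  assert (Bs : forall y s, 0 < s <= sin (y / 2) ->
     Rabs (sin (M * y) / (2 * M * sin (y / 2))) <= / (2 * s) * / INR (S n)).
  { intros y s Hy. set (h := y / 2) in *. unfold Rdiv. rewrite Rabs_mult, Rabs_inv.
    rewrite (Rabs_right (2 * M * sin h)) by nra.
    rewrite <- Rinv_mult. rewrite <- (Rmult_1_l (/ (2 * s * INR (S n)))).
    apply Rmult_le_compat; [apply Rabs_pos|apply Rlt_le, Rinv_0_lt_compat; nra| |].
    - generalize (SIN_bound (M * y)); intros; apply Rabs_le; lra.
    - apply Rinv_le_contravar; nra. }
  assert (B3 := Bs x s0 ltac:(lra)).
  assert (B4 := Bs PI 1 ltac:(rewrite sin_PI2; lra)).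
  revert B1. unfold log_sine_remainder. fold M. rewrite sin_PI2.
  rewrite sin_PI2 in B4. rewrite !Rmult_1_r in *. intros B1.
  apply Rabs_le_between in B1. apply Rabs_le_between in B2.
  apply Rabs_le_between in B3. apply Rabs_le_between in B4.
  apply Rabs_le. rewrite !Rmult_plus_distr_r. lra.
Qed.

(** The series of derivatives converges only conditionally, whence the need for a
    uniform rate on compact subintervals of [(0, 2 PI)]. *)
Lemma Cl_2_derive (x : R) : 0 < x < 2 * PI -> is_derive (Cl 2) x (- ln (2 * sin (x / 2))).
Proof.
intros Hx. assert (HPI := PI_RGT_0).
(* (a, 2 PI - a) is symmetric around PI, so that sin (y / 2) is least at its ends *)
set (a := Rmin x (2 * PI - x) / 2).
assert (Ha : 0 < a < PI /\ a < x < 2 * PI - a).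
{ unfold a, Rmin; destruct Rle_dec; lra. }
assert (Hs0 : 0 < sin (a / 2)) by (apply sin_gt_0; lra).
assert (Hs : forall y, a <= y <= 2 * PI - a -> sin (a / 2) <= sin (y / 2)).
{ intros y Hy. destruct (Rle_dec y PI).
  - apply sin_incr_1; lra.
  - rewrite <- (sin_PI_x (y / 2)). apply sin_incr_1; lra. }
destruct (log_sine_fourier_uniform _ Hs0) as [C HC].
apply (is_derive_uniform_limit
  (fun n y => sum_n (fun k => sin (INR (S k) * y) / INR (S k) ^ 2) n) cos_sum (Cl 2)
  (fun y => - ln (2 * sin (y / 2))) (fun n => C * / INR (S n)) a (2 * PI - a)); [| | | |lra].
- intros n y Hy. unfold cos_sum.
  apply (is_derive_sum_n (fun k y => sin (INR (S k) * y) / INR (S k) ^ 2) n y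
    (fun k => cos (INR (S k) * y) / INR (S k))).
  intros k _. generalize (INR_S_pos k). generalize (INR (S k)); intros K HK.
  auto_derive; [exact I|]. field. lra.
- intros y Hy.
  assert (Hex : ex_series (fun k => sin (INR (S k) * y) / INR (S k) ^ 2)).
  { apply (ex_series_dominated _ (fun k => / INR (S k) ^ 2)); [|exact ex_series_inv_square].
    intros k. destruct (inv_pow_le 2 k (le_n 2)).
    unfold Rdiv. rewrite Rabs_mult, (Rabs_right (/ _)) by lra.
    generalize (SIN_bound (INR (S k) * y)); intros.
    assert (Rabs (sin (INR (S k) * y)) <= 1) by (apply Rabs_le; lra). nra. }
  exact (Series_correct _ Hex).
- replace 0 with (C * 0) by ring. apply is_lim_seq_mult'; [apply is_lim_seq_const|].
  apply (is_lim_seq_incr_1 (fun n => / INR n)).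
  apply (is_lim_seq_inv INR p_infty); [apply is_lim_seq_INR|easy].
- intros n y Hy. apply HC; [lra|apply Hs; lra|].
  intros t. unfold Rmin, Rmax; destruct Rle_dec; intros; apply Hs; lra.
Qed.

(** The sign makes the derivative of each function minus the previous one.  At [k = 0],
    [Cl 1] is replaced by its sum in closed form. *)
Definition signed_Cl (k : nat) (x : R) : R :=
  match k with
  | O => - ln (2 * sin (x / 2))
  | S _ => (-1) ^ ((k + 1) / 2) * Cl (k + 1) x
  end.

Lemma Cl_term_bound (n k : nat) (x : R) : (2 <= n)%nat ->
  Rabs ((if Nat.even n then sin (INR (S k) * x) else cos (INR (S k) * x)) / INR (S k) ^ n)
  <= / INR (S k) ^ 2.
Proof.
intros Hn. destruct (inv_pow_le n k Hn). unfold Rdiv.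
rewrite Rabs_mult, (Rabs_right (/ _)) by lra.
assert (Rabs (if Nat.even n then sin (INR (S k) * x) else cos (INR (S k) * x)) <= 1).
{ generalize (SIN_bound (INR (S k) * x)) (COS_bound (INR (S k) * x)); intros.
  destruct (Nat.even n); apply Rabs_le; lra. }
nra.
Qed.

Lemma Cl_derive (n : nat) (x : R) : (2 <= n)%nat ->
  is_derive (Cl (S n)) x ((if Nat.even n then -1 else 1) * Cl n x).
Proof.
intros Hn. unfold Cl. rewrite <- Series_scal_l.
apply (is_derive_Series (fun k y =>
    (if Nat.even (S n) then sin (INR (S k) * y) else cos (INR (S k) * y)) / INR (S k) ^ S n)
  (fun k y => (if Nat.even n then -1 else 1) *
    ((if Nat.even n then sin (INR (S k) * y) else cos (INR (S k) * y)) / INR (S k) ^ n))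
  (fun k => / INR (S k) ^ 2) (x - 1) (x + 1)); [| | | |lra].
- intros k y _. rewrite Nat.even_succ, <- Nat.negb_even.
  generalize (INR_S_pos k). generalize (INR (S k)); intros K HK.
  assert (K ^ n <> 0) by (apply pow_nonzero; lra).
  assert (K ^ S n <> 0) by (apply pow_nonzero; lra).
  destruct (Nat.even n); cbv [negb].
  + replace (-1 * (sin (K * y) / K ^ n)) with (- (K * sin (K * y)) / K ^ S n)
      by (simpl; field; lra).
    generalize dependent (K ^ S n); intros; auto_derive; [exact I|]. field; lra.
  + replace (1 * (cos (K * y) / K ^ n)) with ((K * cos (K * y)) / K ^ S n)
      by (simpl; field; lra).
    generalize dependent (K ^ S n); intros; auto_derive; [exact I|]. field; lra.
- intros y _. apply (ex_series_dominated _ (fun k => / INR (S k) ^ 2)).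
  + intros k; apply Cl_term_bound; lia.
  + exact ex_series_inv_square.
- intros k y _. rewrite Rabs_mult.
  replace (Rabs (if Nat.even n then -1 else 1)) with 1
    by (destruct (Nat.even n); unfold Rabs; destruct Rcase_abs; lra).
  rewrite Rmult_1_l. now apply Cl_term_bound.
- exact ex_series_inv_square.
Qed.

Lemma signed_Cl_derive (k : nat) (x : R) : 0 < x < 2 * PI ->
  is_derive (signed_Cl (S k)) x (- signed_Cl k x).
Proof.
intros Hx. destruct k as [|k].
- unfold signed_Cl.
  replace (- - ln (2 * sin (x / 2))) with ((-1) ^ 1 * (- ln (2 * sin (x / 2)))) by ring.
  apply (is_derive_scal (Cl 2) x ((-1) ^ 1)). now apply Cl_2_derive.
- unfold signed_Cl.
  replace (S (S k) + 1)%nat with (S (S k + 1)) by lia.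
  replace (- ((-1) ^ ((S k + 1) / 2) * Cl (S k + 1) x)) with
    ((-1) ^ (S (S k + 1) / 2) * ((if Nat.even (S k + 1) then -1 else 1) * Cl (S k + 1) x)).
  + apply (is_derive_scal (Cl (S (S k + 1)))). apply Cl_derive; lia.
  + replace (S k + 1)%nat with (S (S k)) by lia. rewrite Nat.even_succ_succ.
    destruct (Nat.even k) eqn:E.
    * apply Nat.even_spec in E. destruct E as [j ->].
      replace (S (S (S (2 * j)))) with (1 + (j + 1) * 2)%nat by lia.
      replace (S (S (2 * j))) with ((j + 1) * 2)%nat by lia.
      rewrite Nat.div_add, Nat.div_mul by lia. simpl (1 / 2)%nat. rewrite Nat.add_0_l. ring.
    * assert (O : Nat.odd k = true) by (now rewrite <- Nat.negb_even, E).
      apply Nat.odd_spec in O. destruct O as [j ->].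
      replace (S (S (S (2 * j + 1)))) with ((j + 2) * 2)%nat by lia.
      replace (S (S (2 * j + 1))) with (1 + (j + 1) * 2)%nat by lia.
      rewrite Nat.div_add, Nat.div_mul by lia. simpl (1 / 2)%nat. rewrite Nat.add_0_l.
      replace (j + 2)%nat with (S (j + 1)) by lia. simpl. ring.
Qed.

Lemma Cl_continuous (n : nat) (x : R) : (2 <= n)%nat -> continuous (Cl n) x.
Proof.
intros Hn. apply (continuous_Series (fun k y =>
  (if Nat.even n then sin (INR (S k) * y) else cos (INR (S k) * y)) / INR (S k) ^ n)
  (fun k => / INR (S k) ^ 2)).
- intros k y. generalize (INR_S_pos k); generalize (INR (S k)); intros K HK.
  apply ex_derive_continuous with (f := fun y => (if Nat.even n then sin (K * y) else cos (K * y)) / K ^ n).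
  assert (K ^ n <> 0) by (apply pow_nonzero; lra).
  generalize dependent (K ^ n); intros.
  destruct (Nat.even n); auto_derive; exact I.
- intros k y; now apply Cl_term_bound.
- exact ex_series_inv_square.
Qed.

Lemma signed_Cl_continuous (k : nat) (x : R) : (1 <= k)%nat -> continuous (signed_Cl k) x.
Proof.
intros Hk. destruct k as [|k]; [lia|].
apply (continuous_scal_r ((-1) ^ ((S k + 1) / 2)) (Cl (S k + 1))).
apply Cl_continuous; lia.
Qed.

Lemma signed_Cl_0 (k : nat) : (1 <= k)%nat ->
  signed_Cl k 0 = (if Nat.even k then (-1) ^ (k / 2) * zeta (INR (k + 1)) else 0).
Proof.
intros Hk. destruct k as [|k]; [lia|]. unfold signed_Cl, Cl.
replace (S k + 1)%nat with (S (S k)) by lia.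
rewrite (Nat.even_succ (S k)), <- Nat.negb_even.
destruct (Nat.even (S k)) eqn:E; cbv [negb].
- apply Nat.even_spec in E. destruct E as [j Ej].
  replace (S (S k)) with (1 + j * 2)%nat by lia. replace (S k) with (j * 2)%nat by lia.
  rewrite Nat.div_add, Nat.div_mul by lia. simpl (1 / 2)%nat. rewrite Nat.add_0_l.
  f_equal. rewrite zeta_INR. apply Series_ext; intros i.
  rewrite Rmult_0_r, cos_0. unfold Rdiv; ring.
- rewrite Series_0; [ring|]. intros i. rewrite Rmult_0_r, sin_0. unfold Rdiv; ring.
Qed.

(** * Repeated integration *)

(** [n (2 n + 1) ... (2 n + k)], which is [denom (k + 1) p n] without its last factor. *)
Definition rising (k n : nat) : R :=
  INR n * fold_right Rmult 1 (map (fun i => INR (2 * n + i)) (seq 1 k)).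

Lemma rising_succ (k n : nat) : rising (S k) n = rising k n * INR (2 * n + S k).
Proof.
unfold rising. rewrite seq_S, map_app, Rmult_assoc. f_equal. simpl (map _ (_ :: _)).
change (n + (n + 0))%nat with (2 * n)%nat.
generalize (INR (2 * n + S k)); intros r.
induction (map (fun i => INR (2 * n + i)) (seq 1 k)) as [|a l IH]; simpl; [ring|].
rewrite IH; ring.
Qed.

Lemma rising_ge1 (k n : nat) : (1 <= n)%nat -> 1 <= rising k n.
Proof.
intros Hn. induction k as [|k IH].
- unfold rising; simpl. rewrite Rmult_1_r. now apply (le_INR 1).
- rewrite rising_succ. assert (1 <= INR (2 * n + S k)) by (apply (le_INR 1); lia). nra.
Qed.

Lemma is_derive_sum_n_m (f : nat -> R -> R) (d : nat -> R) (n m : nat) (x : R) :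
  (forall k, (n <= k <= m)%nat -> is_derive (f k) x (d k)) ->
  is_derive (fun y => sum_n_m (fun k => f k y) n m) x (sum_n_m d n m).
Proof.
intros Hf. induction m as [|m IH].
- destruct n as [|n].
  + rewrite sum_n_n. apply (is_derive_ext (f 0%nat)); [intros; now rewrite sum_n_n|].
    apply Hf; lia.
  + rewrite sum_n_m_zero by lia.
    apply (is_derive_ext (fun _ => zero)); [intros; now rewrite sum_n_m_zero by lia|].
    apply @is_derive_const.
- destruct (le_lt_dec n (S m)) as [H|H].
  + rewrite sum_n_Sm by lia.
    apply (is_derive_ext (fun y => plus (sum_n_m (fun k => f k y) n m) (f (S m) y)));
      [intros; now rewrite sum_n_Sm by lia|].
    apply @is_derive_plus; [apply IH; intros; apply Hf; lia|apply Hf; lia].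
  + rewrite sum_n_m_zero by lia.
    apply (is_derive_ext (fun _ => zero)); [intros; now rewrite sum_n_m_zero by lia|].
    apply @is_derive_const.
Qed.

Lemma Rsum_scal (c : R) (a : nat -> R) (n m : nat) :
  sum_n_m (fun k => c * a k) n m = c * sum_n_m a n m.
Proof. exact (sum_n_m_mult_l c a n m). Qed.

Definition phi (k : nat) (z : R) : R :=
  Series (fun j => zeta (INR (2 * S j)) / rising k (S j) * z ^ (2 * S j)).

Definition zeta_tail_term (q i : nat) : R := (-1) ^ i * zeta (INR (2 * i + 1)) / INR (fact (q - 2 * i)).

(** The case [p = 0] of the theorem for [m = q]: there the logarithmic terms combine to
    [ln x - harmonic q], and the Kronecker term is the summand [i = q / 2] of the last
    sum when [q] is even.  Unlike the general formula it makes sense for [q = 0]. *)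
Definition phi_closed (q : nat) (x : R) : R :=
  (ln x - harmonic q) / INR (fact q) + (-1) ^ q * signed_Cl q x / x ^ q
  - sum_n_m (fun i => zeta_tail_term q i / x ^ (2 * i)) 1 (q / 2).

(** Recursion on [p] that shifts [q], rather than a sum over an interval: the derivative
    then telescopes by induction. *)
Fixpoint clausen_sum (q p : nat) (x : R) : R :=
  x ^ p / INR (fact p) * signed_Cl (S q) x +
  match p with O => 0 | S p' => clausen_sum (S q) p' x end.

Lemma clausen_sum_p0 (q : nat) (x : R) : clausen_sum q 0 x = signed_Cl (S q) x.
Proof.
unfold clausen_sum. change (INR (fact 0)) with 1. change (x ^ 0) with 1. field.
Qed.

(** The derivative of the leading factor [x ^ p / p!] produces the term that the
    induction hypothesis cancels. *)
Lemma clausen_sum_derive (p : nat) : forall q x, 0 < x < 2 * PI ->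
  is_derive (clausen_sum q p) x (- (x ^ p / INR (fact p) * signed_Cl q x)).
Proof.
induction p as [|p IH]; intros q x Hx.
- apply (is_derive_ext (signed_Cl (S q))).
  { intros y. now rewrite clausen_sum_p0. }
  replace (- (x ^ 0 / INR (fact 0) * signed_Cl q x)) with (- signed_Cl q x) by (simpl; field).
  now apply signed_Cl_derive.
- assert (Hf : INR (fact p) <> 0) by apply INR_fact_neq_0.
  assert (HS := INR_S_pos p).
  assert (E : INR (fact (S p)) = INR (S p) * INR (fact p)).
  { rewrite <- mult_INR. reflexivity. }
  assert (D1 : is_derive (fun y => y ^ S p / INR (fact (S p))) x (x ^ p / INR (fact p))).
  { apply (is_derive_ext (fun y => / INR (fact p) * y ^ S p / INR (S p))).
    { intros y. rewrite E. as_real_eq. field. split; [exact Hf|lra]. }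
    replace (x ^ p / INR (fact p)) with (/ INR (fact p) * x ^ p) by apply Rmult_comm.
    apply is_derive_pow_div. }
  assert (D2 := is_derive_mult _ _ _ _ _ D1 (signed_Cl_derive q x Hx) Rmult_comm).
  assert (D3 := is_derive_plus _ _ _ _ _ D2 (IH (S q) x Hx)).
  cbv beta in D3. change plus with Rplus in D3. change mult with Rmult in D3.
  replace (- (x ^ S p / INR (fact (S p)) * signed_Cl q x)) with
    (x ^ p / INR (fact p) * signed_Cl (S q) x + x ^ S p / INR (fact (S p)) * - signed_Cl q x
     + - (x ^ p / INR (fact p) * signed_Cl (S q) x)) by ring.
  exact D3.
Qed.

Lemma clausen_sum_continuous (p : nat) : forall q x, continuous (clausen_sum q p) x.
Proof.
assert (T : forall p q x, continuous (fun x => x ^ p / INR (fact p) * signed_Cl (S q) x) x).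
{ intros n q x. apply (continuous_mult (fun x => x ^ n / INR (fact n)) (signed_Cl (S q))).
  - apply (ex_derive_continuous (fun x => x ^ n / INR (fact n))).
    generalize (INR_fact_neq_0 n). generalize (INR (fact n)); intros. now auto_derive.
  - apply signed_Cl_continuous; lia. }
induction p as [|p IH]; intros q x.
- apply (continuous_plus (fun x => x ^ 0 / INR (fact 0) * signed_Cl (S q) x) (fun _ => 0)).
  + apply T.
  + apply continuous_const.
- apply (continuous_plus (fun x => x ^ S p / INR (fact (S p)) * signed_Cl (S q) x)
    (clausen_sum (S q) p)); [apply T|apply IH].
Qed.

Lemma clausen_sum_0 (p : nat) : forall q, clausen_sum q p 0 = signed_Cl (S q + p) 0.
Proof.
induction p as [|p IH]; intros q.
- now rewrite clausen_sum_p0, Nat.add_0_r.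
- change (clausen_sum q (S p) 0) with
    (0 ^ S p / INR (fact (S p)) * signed_Cl (S q) 0 + clausen_sum (S q) p 0).
  rewrite IH, pow_i by lia. replace (S (S q) + p)%nat with (S q + S p)%nat by lia.
  unfold Rdiv; ring.
Qed.

Lemma clausen_sum_sum_n_m (p : nat) : forall q x,
  clausen_sum q p x =
  sum_n_m (fun k => x ^ (S q + p - k) / INR (fact (S q + p - k)) * signed_Cl k x) (S q) (S q + p).
Proof.
induction p as [|p IH]; intros q x.
- rewrite Nat.add_0_r, sum_n_n, Nat.sub_diag, clausen_sum_p0.
  change (INR (fact 0)) with 1. change (x ^ 0) with 1. as_real_eq. field.
- rewrite sum_Sn_m by lia.
  change (clausen_sum q (S p) x) with
    (x ^ S p / INR (fact (S p)) * signed_Cl (S q) x + clausen_sum (S q) p x).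
  rewrite IH. replace (S (S q) + p)%nat with (S q + S p)%nat by lia.
  replace (S q + S p - S q)%nat with (S p) by lia. reflexivity.
Qed.

(** [x ^ (m + p)] times the right-hand side of the theorem, for [m = q + 1] and
    [x = 2 PI z].  The value of [clausen_sum] at 0 gives the Kronecker term. *)
Definition closed_form (q p : nat) (x : R) : R :=
  (x ^ (S q + p) * ln x / INR (S q + p) - harmonic q * x ^ (S q + p) / INR (S q + p)
   - x ^ (S q + p) / INR (S q + p) ^ 2) / INR (fact q)
  + (-1) ^ S q * INR (fact p) * (clausen_sum q p x - clausen_sum q p 0)
  - sum_n_m (fun i => zeta_tail_term q i * x ^ (S q + p - 2 * i) / INR (S q + p - 2 * i)) 1 (q / 2).

Lemma half_le (q i : nat) : (i <= q / 2)%nat -> (2 * i <= q)%nat.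
Proof. intros Hi. generalize (Nat.Div0.mul_div_le q 2). lia. Qed.

Lemma zeta_tail_sum_derive (q p : nat) (x : R) :
  is_derive (fun y => sum_n_m (fun i => zeta_tail_term q i * y ^ (S q + p - 2 * i)
     / INR (S q + p - 2 * i)) 1 (q / 2)) x
    (sum_n_m (fun i => zeta_tail_term q i * x ^ (q + p - 2 * i)) 1 (q / 2)).
Proof.
apply (is_derive_sum_n_m (fun i y => zeta_tail_term q i * y ^ (S q + p - 2 * i)
     / INR (S q + p - 2 * i))).
intros i [_ Hi]. apply half_le in Hi.
replace (S q + p - 2 * i)%nat with (S (q + p - 2 * i)) by lia. apply is_derive_pow_div.
Qed.

Lemma closed_form_derive (q p : nat) (x : R) : 0 < x < 2 * PI ->
  is_derive (closed_form q p) x (x ^ (q + p) * phi_closed q x).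
Proof.
intros Hx.
assert (HN := INR_S_pos (q + p)). assert (Hq := INR_fact_neq_0 q). assert (Hp := INR_fact_neq_0 p).
assert (D1 : is_derive (fun x => (x ^ (S q + p) * ln x / INR (S q + p)
   - harmonic q * x ^ (S q + p) / INR (S q + p)
   - x ^ (S q + p) / INR (S q + p) ^ 2) / INR (fact q)) x
   (x ^ (q + p) * ((ln x - harmonic q) / INR (fact q)))).
{ replace (x ^ (q + p)) with (x ^ (pred (S q + p))) by (f_equal; lia).
  assert (Ex : x ^ (S q + p) = x * x ^ (pred (S q + p))) by reflexivity.
  change (S q + p)%nat with (S (q + p)) in Ex |- *.
  revert Ex HN. generalize (S (q + p)); intros N Ex HN.
  auto_derive; [lra|]. rewrite Ex. field. repeat split; lra. }
assert (D2 : is_derive (fun x => (-1) ^ S q * INR (fact p) * (clausen_sum q p x - clausen_sum q p 0)) x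
   (x ^ (q + p) * ((-1) ^ q * signed_Cl q x / x ^ q))).
{ replace (x ^ (q + p) * ((-1) ^ q * signed_Cl q x / x ^ q)) with
    ((-1) ^ S q * INR (fact p) * (- (x ^ p / INR (fact p) * signed_Cl q x) - 0)).
  - apply (is_derive_scal (fun x => clausen_sum q p x - clausen_sum q p 0)).
    apply (is_derive_minus (clausen_sum q p) (fun _ => clausen_sum q p 0)).
    + now apply clausen_sum_derive.
    + apply @is_derive_const.
  - rewrite pow_add. simpl ((-1) ^ S q). field. split; [apply pow_nonzero; lra|exact Hp]. }
assert (D3 := zeta_tail_sum_derive q p x).
assert (D := is_derive_minus _ _ _ _ _ (is_derive_plus _ _ _ _ _ D1 D2) D3).
replace (x ^ (q + p) * phi_closed q x) with
  (x ^ (q + p) * ((ln x - harmonic q) / INR (fact q)) +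
   x ^ (q + p) * ((-1) ^ q * signed_Cl q x / x ^ q) -
   sum_n_m (fun i => zeta_tail_term q i * x ^ (q + p - 2 * i)) 1 (q / 2)).
- exact D.
- unfold phi_closed. rewrite Rmult_minus_distr_l, Rmult_plus_distr_l. f_equal.
  rewrite <- Rsum_scal. apply sum_n_m_ext_loc. intros i [_ Hi]. apply half_le in Hi.
  replace (q + p)%nat with (q + p - 2 * i + 2 * i)%nat at 2 by lia.
  rewrite pow_add. as_real_eq. field. apply pow_nonzero; lra.
Qed.

Lemma right_lim_mult (f g : R -> R) (a l l' : R) :
  filterlim f (at_right a) (locally l) -> filterlim g (at_right a) (locally l') ->
  filterlim (fun x => f x * g x) (at_right a) (locally (l * l')).
Proof.
intros Hf Hg. exact (filterlim_comp_2 _ _ _ Hf Hg (filterlim_mult l l')).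
Qed.

Lemma right_lim_mul_ln : filterlim (fun x => x * ln x) (at_right 0) (locally 0).
Proof.
assert (H := filterlim_comp _ _ _ _ _ _ _ _ filterlim_Rinv_0_right is_lim_div_ln_p).
assert (H2 := right_lim_minus (fun _ => 0) _ 0 0 0 (filterlim_const _) H).
rewrite Rminus_0_r in H2.
eapply filterlim_ext_loc; [|exact H2].
exists (mkposreal 1 Rlt_0_1). intros x _ Hx. cbv beta.
rewrite ln_Rinv by exact Hx. field. lra.
Qed.

Lemma closed_form_right_lim (q p : nat) : filterlim (closed_form q p) (at_right 0) (locally 0).
Proof.
assert (HN := INR_S_pos (q + p)). assert (Hq := INR_fact_neq_0 q).
(* the part that is continuous at 0: all but the logarithm *)
set (g := fun x => (- harmonic q * x ^ (S q + p) / INR (S q + p)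
   - x ^ (S q + p) / INR (S q + p) ^ 2) / INR (fact q)
  + (-1) ^ S q * INR (fact p) * (clausen_sum q p x - clausen_sum q p 0)
  - sum_n_m (fun i => zeta_tail_term q i * x ^ (S q + p - 2 * i) / INR (S q + p - 2 * i)) 1 (q / 2)).
assert (Hg : filterlim g (at_right 0) (locally 0)).
{ apply right_lim_continuous.
  - apply (continuous_minus (fun x => (- harmonic q * x ^ (S q + p) / INR (S q + p)
     - x ^ (S q + p) / INR (S q + p) ^ 2) / INR (fact q)
     + (-1) ^ S q * INR (fact p) * (clausen_sum q p x - clausen_sum q p 0))
     (fun x => sum_n_m (fun i => zeta_tail_term q i * x ^ (S q + p - 2 * i)
        / INR (S q + p - 2 * i)) 1 (q / 2))).
    + apply (continuous_plus (fun x => (- harmonic q * x ^ (S q + p) / INR (S q + p)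
       - x ^ (S q + p) / INR (S q + p) ^ 2) / INR (fact q))
       (fun x => (-1) ^ S q * INR (fact p) * (clausen_sum q p x - clausen_sum q p 0))).
      * apply (ex_derive_continuous (fun x => (- harmonic q * x ^ (S q + p) / INR (S q + p)
         - x ^ (S q + p) / INR (S q + p) ^ 2) / INR (fact q))).
        change (S q + p)%nat with (S (q + p)). revert HN.
        generalize (S (q + p)); intros N HN. auto_derive. exact I.
      * apply (continuous_scal_r ((-1) ^ S q * INR (fact p))
          (fun x => clausen_sum q p x - clausen_sum q p 0)).
        apply (continuous_minus (clausen_sum q p) (fun _ => clausen_sum q p 0)).
        -- apply clausen_sum_continuous.
        -- apply continuous_const.
    + apply (ex_derive_continuous (fun x => sum_n_m (fun i => zeta_tail_term q i
        * x ^ (S q + p - 2 * i) / INR (S q + p - 2 * i)) 1 (q / 2))).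
      eexists. apply zeta_tail_sum_derive.
  - unfold g. rewrite pow_i by lia.
    rewrite (sum_n_m_ext_loc _ (fun _ => zero)).
    + rewrite sum_n_m_const_zero. change (@zero R_AbelianMonoid) with 0. unfold Rdiv; ring.
    + intros i [_ Hi]. apply half_le in Hi. rewrite pow_i by lia.
      change (zero) with 0. as_real_eq. unfold Rdiv; ring. }
assert (Hl : filterlim (fun x => (x ^ (q + p) / (INR (S q + p) * INR (fact q))) * (x * ln x))
   (at_right 0) (locally (0 ^ (q + p) / (INR (S q + p) * INR (fact q)) * 0))).
{ apply right_lim_mult; [|exact right_lim_mul_ln].
  apply right_lim_continuous; [|reflexivity].
  apply (ex_derive_continuous (fun x => x ^ (q + p) / (INR (S q + p) * INR (fact q)))).
  generalize (INR (S q + p) * INR (fact q)) (q + p)%nat; intros. now auto_derive. }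
rewrite Rmult_0_r in Hl.
assert (H := right_lim_minus _ _ _ _ _ Hl
  (right_lim_minus _ _ _ _ _ (filterlim_const (F := at_right 0) 0) Hg)).
replace (0 - (0 - 0)) with 0 in H by ring.
eapply filterlim_ext; [|exact H]. intros x. unfold g, closed_form.
change (S q + p)%nat with (S (q + p)) in *. rewrite <- (tech_pow_Rmult x (q + p)).
field. split; [lra|exact Hq].
Qed.

Lemma zeta_over_rising_bound (k j : nat) :
  Rabs (zeta (INR (2 * S j)) / rising k (S j)) <= zeta (INR 2).
Proof.
assert (H := rising_ge1 k (S j) ltac:(lia)). assert (H2 := zeta_even_bound j).
unfold Rdiv. rewrite Rabs_mult, Rabs_inv, (Rabs_right (rising _ _)) by lra.
assert (/ rising k (S j) <= 1) by (rewrite <- Rinv_1; apply Rinv_le_contravar; lra).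
assert (0 < / rising k (S j)) by (apply Rinv_0_lt_compat; lra).
generalize (Rabs_pos (zeta (INR (2 * S j)))); nra.
Qed.

(** Here [m = q + 1], so that the middle factors of the denominator are [2 n + 1, ..., 2 n + q]. *)
Definition zeta_series (q p : nat) (z : R) : R :=
  Series (fun j => zeta (INR (2 * S j)) * z ^ (2 * S j) / denom (S q) p (S j)).

Lemma denom_rising (q p n : nat) : denom (S q) p n = rising q n * INR (2 * n + (S q + p)).
Proof. unfold denom, rising. rewrite Nat.sub_succ, Nat.sub_0_r, Nat.add_assoc. reflexivity. Qed.

(** In the variable [z], both sides have derivative
    [(2 PI) ^ (m + p) * z ^ (m + p - 1) * phi q z] and tend to 0 at 0, where [m = q + 1]. *)
Lemma integration_step (q p : nat) (z : R) :
  (forall y, 0 < y < 1 -> phi q y = phi_closed q (2 * PI * y)) -> 0 < z < 1 ->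
  (2 * PI * z) ^ (S q + p) * zeta_series q p z = closed_form q p (2 * PI * z).
Proof.
intros Hphi Hz. assert (HPI := PI_RGT_0).
assert (Hc := zeta_over_rising_bound q).
transitivity ((2 * PI) ^ (S q + p) * Series (fun j => zeta (INR (2 * S j)) / rising q (S j)
   * z ^ (2 * S j + (S q + p)) / INR (2 * S j + (S q + p)))).
{ rewrite Rpow_mult_distr, Rmult_assoc. f_equal. unfold zeta_series.
  rewrite <- Series_scal_l. apply Series_ext; intros j.
  assert (H := rising_ge1 q (S j) ltac:(lia)).
  assert (H' : 0 < INR (2 * S j + (S q + p))) by (apply lt_0_INR; lia).
  rewrite denom_rising, (pow_add z (2 * S j) (S q + p)). field. lra. }
revert z Hz.
apply (eq_of_same_derive
  (fun z => (2 * PI) ^ (S q + p) * Series (fun j => zeta (INR (2 * S j)) / rising q (S j)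
   * z ^ (2 * S j + (S q + p)) / INR (2 * S j + (S q + p))))
  (fun z => closed_form q p (2 * PI * z))
  (fun z => (2 * PI) ^ (S q + p) * (z ^ (q + p) * phi q z))).
- intros z Hz.
  apply (is_derive_scal (fun z => Series (fun j => zeta (INR (2 * S j)) / rising q (S j)
   * z ^ (2 * S j + (S q + p)) / INR (2 * S j + (S q + p))))).
  replace (z ^ (q + p) * phi q z) with (Series (fun j => zeta (INR (2 * S j)) / rising q (S j)
   * z ^ (2 * S j + (S q + p) - 1))).
  + apply (is_derive_even_powers _ (zeta (INR 2))); [exact Hc|lra].
  + unfold phi. rewrite <- Series_scal_l. apply Series_ext; intros j.
    replace (2 * S j + (S q + p) - 1)%nat with (2 * S j + (q + p))%nat by lia.
    rewrite pow_add. ring.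
- intros z Hz.
  assert (D : is_derive (fun z => 2 * PI * z) z (2 * PI)) by (auto_derive; [exact I|ring]).
  assert (DD := is_derive_comp _ _ _ _ _ (closed_form_derive q p (2 * PI * z) ltac:(nra)) D).
  rewrite Hphi by exact Hz.
  replace ((2 * PI) ^ (S q + p) * (z ^ (q + p) * phi_closed q (2 * PI * z))) with
    (2 * PI * ((2 * PI * z) ^ (q + p) * phi_closed q (2 * PI * z))).
  + exact DD.
  + rewrite (Rpow_mult_distr (2 * PI) z). change (S q + p)%nat with (S (q + p)).
    rewrite <- (tech_pow_Rmult (2 * PI)). ring.
- replace 0 with (0 - 0) at 2 by ring. apply right_lim_minus.
  + replace 0 with ((2 * PI) ^ (S q + p) * 0) at 2 by ring.
    apply right_lim_mult; [apply filterlim_const|].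
    apply (right_lim_even_powers _ (zeta (INR 2))). exact Hc.
  + eapply filterlim_comp; [|apply closed_form_right_lim].
    intros P [d Hd].
    assert (Hd' : 0 < d / (2 * PI)) by (apply Rdiv_lt_0_compat; [apply cond_pos|lra]).
    assert (K : forall y : R, y < d / (2 * PI) -> 2 * PI * y < d).
    { intros y Hy. apply Rmult_lt_compat_l with (r := 2 * PI) in Hy; [|lra].
      replace (2 * PI * (d / (2 * PI))) with (pos d) in Hy by (field; lra). exact Hy. }
    exists (mkposreal _ Hd'). intros y Hy Hy0.
    apply Hd; [|nra]. change (Rabs (y - 0) < d / (2 * PI)) in Hy.
    change (Rabs (2 * PI * y - 0) < d). rewrite Rminus_0_r in *.
    rewrite Rabs_right in * by nra.
    now apply K.
Qed.

Lemma phi_succ (q : nat) (z : R) : phi (S q) z = zeta_series q 0 z.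
Proof.
apply Series_ext; intros j. rewrite denom_rising, rising_succ, Nat.add_0_r.
unfold Rdiv; ring.
Qed.

Lemma harmonic_succ (q : nat) : harmonic (S q) = harmonic q + / INR (S q).
Proof. unfold harmonic. now rewrite sum_n_Sm by lia. Qed.

(** The value [signed_Cl (q + 1) 0] is nonzero only for odd [q]; it is then the new last
    summand [i = (q + 1) / 2] of the sum of odd zeta values. *)
Lemma closed_form_phi_closed (q : nat) (x : R) : 0 < x ->
  closed_form q 0 x = x ^ S q * phi_closed (S q) x.
Proof.
intros Hx. unfold closed_form, phi_closed. rewrite Nat.add_0_r.
assert (HS := INR_S_pos q). assert (Hq := INR_fact_neq_0 q).
assert (HX : x ^ S q <> 0) by (apply pow_nonzero; lra).
assert (E : INR (fact (S q)) = INR (S q) * INR (fact q)) by (rewrite <- mult_INR; reflexivity).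
assert (T : forall i, (2 * i <= q)%nat ->
  zeta_tail_term q i * x ^ (S q - 2 * i) / INR (S q - 2 * i) =
  x ^ S q * (zeta_tail_term (S q) i / x ^ (2 * i))).
{ intros i Hi. unfold zeta_tail_term.
  replace (S q - 2 * i)%nat with (S (q - 2 * i)) by lia.
  assert (E2 : INR (fact (S (q - 2 * i))) = INR (S (q - 2 * i)) * INR (fact (q - 2 * i)))
    by (rewrite <- mult_INR; reflexivity).
  replace (x ^ S q) with (x ^ (S (q - 2 * i)) * x ^ (2 * i)) by (rewrite <- pow_add; f_equal; lia).
  rewrite E2. generalize (INR_S_pos (q - 2 * i)) (INR_fact_neq_0 (q - 2 * i)); intros.
  field. repeat split; try lra. apply pow_nonzero; lra. }
assert (Z : sum_n_m (fun i => zeta_tail_term q i * x ^ (S q - 2 * i) / INR (S q - 2 * i)) 1 (q / 2)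
  + (-1) ^ S q * signed_Cl (S q) 0 =
  x ^ S q * sum_n_m (fun i => zeta_tail_term (S q) i / x ^ (2 * i)) 1 (S q / 2)).
{ rewrite <- Rsum_scal.
  rewrite (sum_n_m_ext_loc _ (fun i => x ^ S q * (zeta_tail_term (S q) i / x ^ (2 * i))) 1 (q / 2))
    by (intros i [_ Hi]; apply T, half_le, Hi).
  rewrite signed_Cl_0 by lia.
  destruct (Nat.even (S q)) eqn:Ev.
  - apply Nat.even_spec in Ev. destruct Ev as [j Ej].
    destruct j as [|j]; [lia|].
    assert (Q : (S q / 2 = S j)%nat) by (replace (S q) with (S j * 2)%nat by lia; now rewrite Nat.div_mul).
    assert (Q' : (q / 2 = j)%nat) by (replace q with (1 + j * 2)%nat by lia; now rewrite Nat.div_add).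
    rewrite Q, Q', sum_n_Sm by lia. change plus with Rplus. f_equal.
    unfold zeta_tail_term. rewrite <- Ej, Nat.sub_diag.
    replace ((-1) ^ S q) with 1.
    + change (INR (fact 0)) with 1. as_real_eq. field. exact HX.
    + rewrite Ej. rewrite pow_1_even. reflexivity.
  - assert (O : Nat.odd (S q) = true) by (now rewrite <- Nat.negb_even, Ev).
    apply Nat.odd_spec in O. destruct O as [j Ej].
    assert (Q : (S q / 2 = q / 2)%nat).
    { replace (S q) with (1 + j * 2)%nat by lia. replace q with (j * 2)%nat by lia.
      rewrite Nat.div_add, Nat.div_mul by lia. reflexivity. }
    rewrite Q. ring. }
rewrite (Rmult_minus_distr_l (x ^ S q)
  ((ln x - harmonic (S q)) / INR (fact (S q)) + (-1) ^ S q * signed_Cl (S q) x / x ^ S q)).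
rewrite <- Z, clausen_sum_0, Nat.add_0_r, harmonic_succ, E.
rewrite clausen_sum_p0. change (INR (fact 0)) with 1. field. lra.
Qed.

Lemma phi_closed_form (q : nat) : forall z, 0 < z < 1 -> phi q z = phi_closed q (2 * PI * z).
Proof.
assert (HPI := PI_RGT_0).
induction q as [|q IH]; intros z Hz.
- transitivity (ln (2 * PI * z) - ln (2 * sin (PI * z))).
  + rewrite <- log_sine_zeta by exact Hz. apply Series_ext; intros j.
    unfold rising. simpl map. simpl fold_right. rewrite Rmult_1_r. unfold Rdiv; ring.
  + unfold phi_closed, harmonic, signed_Cl. simpl (0 / 2)%nat. rewrite !sum_n_m_zero by lia.
    change (@zero R_AbelianMonoid) with 0.
    replace (2 * PI * z / 2) with (PI * z) by field. simpl. field.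
- assert (HX : 0 < 2 * PI * z) by nra.
  apply Rmult_eq_reg_l with ((2 * PI * z) ^ S q); [|apply pow_nonzero; lra].
  rewrite <- closed_form_phi_closed by exact HX.
  rewrite phi_succ, <- (integration_step q 0 z IH Hz). now rewrite Nat.add_0_r.
Qed.

Lemma is_series_zeta_series (q p : nat) (z : R) : 0 < z < 1 ->
  is_series (fun j => zeta (INR (2 * S j)) * z ^ (2 * S j) / denom (S q) p (S j))
    (zeta_series q p z).
Proof.
intros Hz. apply Series_correct.
apply (ex_series_ext (fun j => (zeta (INR (2 * S j)) / rising q (S j))
   / INR (2 * S j + (S q + p)) * z ^ (2 * S j + 0))).
- intros j. rewrite denom_rising, Nat.add_0_r.
  assert (H := rising_ge1 q (S j) ltac:(lia)).
  assert (H' : 0 < INR (2 * S j + (S q + p))) by (apply lt_0_INR; lia). as_real_eq. field. lra.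
- apply (ex_series_even_powers _ (zeta (INR 2))); [|lra].
  intros j. assert (B := zeta_over_rising_bound q j).
  assert (H' : 1 <= INR (2 * S j + (S q + p))) by (apply (le_INR 1); lia).
  unfold Rdiv at 1. rewrite Rabs_mult, Rabs_inv, (Rabs_right (INR (_ + _))) by lra.
  assert (/ INR (2 * S j + (S q + p)) <= 1) by (rewrite <- Rinv_1; apply Rinv_le_contravar; lra).
  assert (0 < / INR (2 * S j + (S q + p))) by (apply Rinv_0_lt_compat; lra).
  generalize (Rabs_pos (zeta (INR (2 * S j)) / rising q (S j))); nra.
Qed.

Lemma kronecker_half (N : nat) :
  kronecker (INR (N / 2)) (INR N / 2) = if Nat.even N then 1 else 0.
Proof.
unfold kronecker. destruct (Nat.even N) eqn:E.
- apply Nat.even_spec in E. destruct E as [j ->].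
  replace (2 * j)%nat with (j * 2)%nat by lia. rewrite Nat.div_mul, mult_INR by lia.
  simpl (INR 2). destruct Req_dec_T as [|n]; [reflexivity|]. exfalso; apply n; field.
- assert (O : Nat.odd N = true) by (now rewrite <- Nat.negb_even, E).
  apply Nat.odd_spec in O. destruct O as [j ->].
  replace (2 * j + 1)%nat with (1 + j * 2)%nat by lia.
  rewrite Nat.div_add by lia. simpl (1 / 2)%nat. rewrite Nat.add_0_l, plus_INR, mult_INR.
  simpl (INR 2). simpl (INR 1). destruct Req_dec_T; [lra|reflexivity].
Qed.

Theorem mainTheorem5 (p m : nat) (z : R) (hm : (1 <= m)%nat) (hz : 0 < z < 1) :
  is_series
    (fun j : nat =>
       let n := S j in zeta (INR (2 * n)) * z ^ (2 * n) / denom m p n)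
    ((ln (2 * PI * z) - harmonic (m - 1)) / (INR (fact (m - 1)) * INR (p + m))
     + sum_n_m
         (fun k : nat =>
            (-1) ^ m * INR (fact p) * (-1) ^ ((k + 1) / 2)
            / (INR (fact (p + m - k)) * (2 * PI * z) ^ k)
            * Cl (k + 1) (2 * PI * z))
         m (m + p)
     + kronecker (INR ((p + m) / 2)) (INR (p + m) / 2)
       * ((-1) ^ (m + 1) * INR (fact p) * (-1) ^ ((p + m) / 2)
          / (2 * PI * z) ^ (p + m))
       * zeta (INR (p + m + 1))
     - 1 / (INR (fact (m - 1)) * INR (p + m) ^ 2)
     - sum_n_m
         (fun k : nat =>
            (-1) ^ k * zeta (INR (2 * k + 1))
            / (INR (fact (m - 1 - 2 * k)) * INR (m + p - 2 * k)
               * (2 * PI * z) ^ (2 * k)))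
         1 ((m - 1) / 2)).
Proof.
destruct m as [|q]; [lia|].
assert (HPI := PI_RGT_0).
assert (Hx : 0 < 2 * PI * z) by nra.
assert (Hstep := integration_step q p z (phi_closed_form q) hz).
assert (L := is_series_zeta_series q p z hz).
match goal with |- is_series _ ?v => replace v with (zeta_series q p z); [exact L|] end.
revert Hx Hstep. clear L. generalize (2 * PI * z) (zeta_series q p z). intros x A Hx Hstep.
assert (HX : x ^ (S q + p) <> 0) by (apply pow_nonzero; lra).
apply Rmult_eq_reg_l with (x ^ (S q + p)); [|exact HX].
rewrite Hstep. unfold closed_form.
rewrite (Nat.add_comm p (S q)), kronecker_half.
rewrite Nat.sub_succ, Nat.sub_0_r.
rewrite clausen_sum_0, clausen_sum_sum_n_m.
rewrite (sum_n_m_ext_loc (fun k => (-1) ^ S q * INR (fact p) * (-1) ^ ((k + 1) / 2)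
   / (INR (fact (S q + p - k)) * x ^ k) * Cl (k + 1) x)
   (fun k => (-1) ^ S q * INR (fact p) / x ^ (S q + p) *
      (x ^ (S q + p - k) / INR (fact (S q + p - k)) * signed_Cl k x))).
2:{ intros k Hk. destruct k as [|k]; [lia|]. unfold signed_Cl.
    replace (x ^ (S q + p)) with (x ^ (S q + p - S k) * x ^ S k)
      by (rewrite <- pow_add; f_equal; lia).
    as_real_eq. field. repeat split; try apply pow_nonzero; try lra. apply INR_fact_neq_0. }
rewrite Rsum_scal.
rewrite (sum_n_m_ext_loc (fun k => (-1) ^ k * zeta (INR (2 * k + 1))
   / (INR (fact (q - 2 * k)) * INR (S q + p - 2 * k) * x ^ (2 * k)))
   (fun i => / x ^ (S q + p) * (zeta_tail_term q i * x ^ (S q + p - 2 * i)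
      / INR (S q + p - 2 * i)))).
2:{ intros i [_ Hi]. apply half_le in Hi. unfold zeta_tail_term.
    assert (0 < INR (S q + p - 2 * i)) by (apply lt_0_INR; lia).
    replace (x ^ (S q + p)) with (x ^ (S q + p - 2 * i) * x ^ (2 * i))
      by (rewrite <- pow_add; f_equal; lia).
    as_real_eq. field. repeat split; try apply pow_nonzero; try lra. apply INR_fact_neq_0. }
rewrite Rsum_scal.
rewrite signed_Cl_0 by lia.
assert (HN : 0 < INR (S q + p)) by (apply lt_0_INR; lia).
assert (Hq := INR_fact_neq_0 q).
rewrite (pow_add (-1) (S q) 1), pow_1.
destruct (Nat.even (S q + p)); field; repeat split; (exact HX || exact Hq || lra).
Qed.
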